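(* If $\mathcal{M}$ and $\mathcal{N}$ are $\omega_1$-like models of Peano Arithmetic with the same standard system, then the value groups $v(R(\mathcal{M}))$ and $v(R(\mathcal{N}))$ are isomorphic (as ordered abelian groups).
   Context: A model $\mathcal{M}$ of Peano Arithmetic (PA) is identified with the ordered ring whose nonnegative elements form that model; $R(\mathcal{M})$ denotes the real closure of (the fraction field of) this ordered ring. A linear order is $\omega_1$-like if it is uncountable but every proper initial segment is countable; a model of PA is $\omega_1$-like if the order on its nonnegative elements is. The standard system of a nonstandard model $\mathcal{M}$ of PA is the collection of all sets $r(a)=\{n\in\mathbb{N} : \text{the } n\text{-th prime divides } a\}$ for $a\in\mathcal{M}$. For a real closed field $K$, let $O$ be the convex subring of finite elements (those $x$ with $|x|<n$ for some natural number $n$). The standard valuation $v:K^\times\to\Gamma$ is the valuation with valuation ring $O$, ordered so that $v(x)\le v(y)$ if and only if $y/x\in O$; $v(K)$ denotes its (ordered) value group $\Gamma$. *)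

(* Defs.v *)
From HB Require Import structures.
From mathcomp Require Import all_boot all_order all_algebra.
From mathcomp Require Import fraction generic_quotient.
From mathcomp Require Import boolp classical_sets functions cardinality.

Set Implicit Arguments.
Unset Strict Implicit.
Unset Printing Implicit Defensive.

Import Order.TTheory GRing.Theory Num.Theory.

Local Open Scope ring_scope.
Local Open Scope quotient_scope.
Local Open Scope classical_set_scope.

Lemma next_prime_subproof (m : nat) : exists p, (m < p)%N && prime p.
Proof. by have [p mp p_pr] := prime_above m; exists p; rewrite mp. Qed.

Definition next_prime (m : nat) : nat := ex_minn (next_prime_subproof m).

(* Indexing of the primes starts with [nth_prime 0 = 2]. *)
Definition nth_prime (n : nat) : nat := iter n next_prime 2%N.

Lemma nth_prime_prime n : prime (nth_prime n).
Proof.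
by case: n => //= n; rewrite /next_prime; case: ex_minnP => p /andP[].
Qed.

Lemma count_nth_prime n : count prime (iota 0 (nth_prime n)) = n.
Proof.
elim: n => //= n; have := nth_prime_prime n; rewrite /next_prime.
move: (nth_prime n) => q q_pr IHq; case: ex_minnP => p /andP[qp _] p_min.
have no_prime : count prime (iota q.+1 (p - q.+1)) = 0%N.
  apply/eqP; rewrite -leqn0 leqNgt -has_count; apply/hasPn => r.
  rewrite mem_iota subnKC // => /andP[qr rp]; apply/negP => r_pr.
  by have := p_min r; rewrite qr r_pr leqNgt rp => /(_ isT).
rewrite -(subnKC qp) iotaD count_cat no_prime addn0 -addn1 iotaD count_cat.
by rewrite IHq /= q_pr addn1.
Qed.

Record arith_structure := ArithStructure {
  carrier :> Type;
  azero : carrier;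
  aone : carrier;
  aadd : carrier -> carrier -> carrier;
  amul : carrier -> carrier -> carrier;
  alt : carrier -> carrier -> Prop }.

Inductive term :=
  | Var of nat
  | Zero
  | One
  | Add of term & term
  | Mul of term & term.

(* De Bruijn indices: [All f] binds [Var 0] in [f]. *)
Inductive formula :=
  | Eq of term & term
  | Lt of term & term
  | Bot
  | Imp of formula & formula
  | All of formula.

Section Semantics.
Variable A : arith_structure.

Definition env_cons (x : A) (e : nat -> A) : nat -> A :=
  fun n => if n is m.+1 then e m else x.

Fixpoint eval (e : nat -> A) (t : term) : A :=
  match t with
  | Var n => e n
  | Zero => azero A
  | One => aone A
  | Add t1 t2 => aadd (eval e t1) (eval e t2)
  | Mul t1 t2 => amul (eval e t1) (eval e t2)
  end.

Fixpoint sat (e : nat -> A) (f : formula) : Prop :=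
  match f with
  | Eq t1 t2 => eval e t1 = eval e t2
  | Lt t1 t2 => alt (eval e t1) (eval e t2)
  | Bot => False
  | Imp f1 f2 => sat e f1 -> sat e f2
  | All f1 => forall x : A, sat (env_cons x e) f1
  end.

Definition asucc (x : A) : A := aadd x (aone A).

(* In [pa_induction] the induction variable is [Var 0]; the values [e] of the
   other variables are the parameters. *)
Record PA_model : Prop := {
  pa_succ_neq0 : forall x : A, asucc x <> azero A;
  pa_succ_inj : forall x y : A, asucc x = asucc y -> x = y;
  pa_add0 : forall x : A, aadd x (azero A) = x;
  pa_addS : forall x y : A, aadd x (asucc y) = asucc (aadd x y);
  pa_mul0 : forall x : A, amul x (azero A) = azero A;
  pa_mulS : forall x y : A, amul x (asucc y) = aadd (amul x y) x;
  pa_ltP : forall x y : A, alt x y <-> exists z : A, aadd x (asucc z) = y;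
  pa_induction : forall (f : formula) (e : nat -> A),
    sat (env_cons (azero A) e) f ->
    (forall x : A, sat (env_cons x e) f -> sat (env_cons (asucc x) e) f) ->
    forall x : A, sat (env_cons x e) f }.

Definition numeral (n : nat) : A := iter n asucc (azero A).

Definition coded_set (a : A) : set nat :=
  [set n | exists b : A, amul (numeral (nth_prime n)) b = a].

Definition standard_system : set (set nat) := range coded_set.

End Semantics.

Definition omega1_like (d : Order.disp_t) (T : orderType d) : Prop :=
  ~ countable [set: T] /\
  forall I : set T, (forall x y : T, (x <= y)%O -> I y -> I x) ->
    I <> [set: T] -> countable I.

Section Nonnegative.
Variable M : realDomainType.

Record nonneg := Nonneg { nonneg_val : M; nonnegP : nonneg_val \is Num.nneg }.

HB.instance Definition _ := [isSub for nonneg_val].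
HB.instance Definition _ := [Choice of nonneg by <:].
HB.instance Definition _ := [SubChoice_isSubComNzSemiRing of nonneg by <:].
HB.instance Definition _ :=
  [SubChoice_isSubOrder of nonneg by <: with ring_display].

Definition nonneg_structure : arith_structure :=
  @ArithStructure nonneg 0 1 +%R *%R (fun x y => x < y).

End Nonnegative.

(* The order of the fraction field is determined by that of [M], so an ordered
   embedding of [{fraction M}] is one whose restriction to [M] is monotone. *)
Definition is_real_closure (M : realDomainType) (K : rcfType) : Prop :=
  exists j : {rmorphism {fraction M} -> K},
    {mono (fun a : M => j (tofrac a)) : a b / a <= b} /\
    forall x : K, algebraicOver j x.

Section StandardValuation.
Variable K : rcfType.

Definition finite_elt (x : K) : Prop := exists n : nat, `|x| < n%:R.

Definition nonzero := {x : K | x != 0}.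

Implicit Types x y z : nonzero.

Definition val_le x y : bool := `[< finite_elt (val y / val x) >].

Definition val_equiv x y : bool := val_le x y && val_le y x.

Lemma finite_eltM (a b : K) :
  finite_elt a -> finite_elt b -> finite_elt (a * b).
Proof.
by move=> [m am] [n bn]; exists (m * n)%N; rewrite normrM natrM ltr_pM.
Qed.

Lemma val_le_refl : reflexive val_le.
Proof.
move=> x; apply/asboolP; exists 2%N.
by rewrite divff ?(valP x)// normr1 ltr1n.
Qed.

Lemma val_le_trans : transitive val_le.
Proof.
move=> y x z /asboolP xy /asboolP yz; apply/asboolP.
rewrite (_ : val z / val x = (val z / val y) * (val y / val x)).
  exact: finite_eltM.
by rewrite mulrA divfK ?(valP y).
Qed.

Lemma val_le_total : total val_le.
Proof.
move=> x y; apply/orP.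
have fin1 (a : K) : `|a| <= 1 -> finite_elt a.
  by move=> a1; exists 2%N; rewrite (le_lt_trans a1) ?ltr1n.
have [xy|/ltW yx] := leP `|val y / val x| 1.
  by left; apply/asboolP/fin1.
right; apply/asboolP/fin1; rewrite -invf_div normfV invf_le1 //.
exact: lt_le_trans ltr01 yx.
Qed.

Lemma val_equiv_refl : reflexive val_equiv.
Proof. by move=> x; rewrite /val_equiv val_le_refl. Qed.

Lemma val_equiv_sym : symmetric val_equiv.
Proof. by move=> x y; rewrite /val_equiv andbC. Qed.

Lemma val_equiv_trans : transitive val_equiv.
Proof.
move=> y x z /andP[xy yx] /andP[yz zy].
by rewrite /val_equiv (val_le_trans xy yz) (val_le_trans zy yx).
Qed.

Canonical val_equiv_rel :=
  EquivRel val_equiv val_equiv_refl val_equiv_sym val_equiv_trans.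

(* K^* modulo the units of the ring of finite elements, written additively. *)
Definition value_group := {eq_quot val_equiv}.

HB.instance Definition _ := Choice.on value_group.
HB.instance Definition _ := EqQuotient.on value_group.

Definition v x : value_group := \pi_value_group x.

Definition nonzero1 : nonzero := Sub (1 : K) (oner_neq0 K).

Lemma mul_nonzero_proof x y : val x * val y != 0.
Proof. by rewrite mulf_neq0 ?(valP x) ?(valP y). Qed.
Definition mul_nonzero x y : nonzero := Sub (val x * val y) (mul_nonzero_proof x y).

Lemma inv_nonzero_proof x : (val x)^-1 != 0.
Proof. by rewrite invr_neq0 ?(valP x). Qed.
Definition inv_nonzero x : nonzero := Sub (val x)^-1 (inv_nonzero_proof x).

Definition vzero : value_group := v nonzero1.
Definition vadd (a b : value_group) : value_group :=
  v (mul_nonzero (repr a) (repr b)).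
Definition vopp (a : value_group) : value_group := v (inv_nonzero (repr a)).
Definition vle (a b : value_group) : bool := val_le (repr a) (repr b).
Definition vlt (a b : value_group) : bool := (b != a) && vle a b.

Lemma v_eq x y : (v x == v y) = val_equiv x y.
Proof. by rewrite /v eqmodE. Qed.

Lemma repr_v x : val_equiv (repr (v x)) x.
Proof. by rewrite -v_eq /v reprK. Qed.

Lemma v_repr (a : value_group) : v (repr a) = a.
Proof. exact: reprK. Qed.

Lemma val_le_mul x y z t :
  val_le x y -> val_le z t -> val_le (mul_nonzero x z) (mul_nonzero y t).
Proof.
move=> /asboolP xy /asboolP zt; apply/asboolP.
by rewrite !SubK invfM mulrACA; apply: finite_eltM.
Qed.

Lemma val_le_inv x y : val_le x y -> val_le (inv_nonzero y) (inv_nonzero x).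
Proof.
by move=> /asboolP xy; apply/asboolP; rewrite !SubK invrK mulrC.
Qed.

Lemma vaddE x y : vadd (v x) (v y) = v (mul_nonzero x y).
Proof.
apply/eqP; rewrite v_eq.
have /andP[xx' x'x] := repr_v x; have /andP[yy' y'y] := repr_v y.
by rewrite /val_equiv !val_le_mul.
Qed.

Lemma voppE x : vopp (v x) = v (inv_nonzero x).
Proof.
apply/eqP; rewrite v_eq; have /andP[xx' x'x] := repr_v x.
by rewrite /val_equiv !val_le_inv.
Qed.

Lemma vleE x y : vle (v x) (v y) = val_le x y.
Proof.
have /andP[xx' x'x] := repr_v x; have /andP[yy' y'y] := repr_v y.
apply/idP/idP => xy; first exact: val_le_trans (val_le_trans x'x xy) yy'.
exact: val_le_trans (val_le_trans xx' xy) y'y.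
Qed.

Lemma vaddA : associative vadd.
Proof.
move=> a b c; rewrite -(v_repr a) -(v_repr b) -(v_repr c) !vaddE.
by congr v; apply/val_inj; rewrite !SubK mulrA.
Qed.

Lemma vaddC : commutative vadd.
Proof.
move=> a b; rewrite -(v_repr a) -(v_repr b) !vaddE.
by congr v; apply/val_inj; rewrite !SubK mulrC.
Qed.

Lemma vadd0 : left_id vzero vadd.
Proof.
move=> a; rewrite -(v_repr a) vaddE.
by congr v; apply/val_inj; rewrite !SubK mul1r.
Qed.

Lemma vaddN : left_inverse vzero vopp vadd.
Proof.
move=> a; rewrite -(v_repr a) voppE vaddE.
by congr v; apply/val_inj; rewrite !SubK mulVf ?(valP (repr a)).
Qed.

HB.instance Definition _ :=
  GRing.isZmodule.Build value_group vaddA vaddC vadd0 vaddN.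

Lemma vle_refl : reflexive vle.
Proof. by move=> a; apply: val_le_refl. Qed.

Lemma vle_anti : antisymmetric vle.
Proof.
move=> a b; rewrite -(v_repr a) -(v_repr b) !vleE => ab.
by apply/eqP; rewrite v_eq.
Qed.

Lemma vle_trans : transitive vle.
Proof. by move=> b a c; apply: val_le_trans. Qed.

Lemma vle_total : total vle.
Proof. by move=> a b; apply: val_le_total. Qed.

HB.instance Definition _ := Order.isPOrder.Build ring_display value_group
  (fun _ _ => erefl) vle_refl vle_anti vle_trans.

HB.instance Definition _ :=
  Order.POrder_isTotal.Build ring_display value_group vle_total.

Lemma vM x y : v (mul_nonzero x y) = v x + v y.
Proof. by rewrite -[RHS]/(vadd _ _) vaddE. Qed.

Lemma v_leP x y : reflect (finite_elt (val y / val x)) (v x <= v y).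
Proof. by rewrite -[_ <= _]/(vle _ _) vleE; apply: asboolP. Qed.

Lemma v_surj (a : value_group) : exists x, v x = a.
Proof. by exists (repr a); apply: v_repr. Qed.

Lemma value_group_leD (a b c : value_group) : a <= b -> c + a <= c + b.
Proof.
rewrite -(v_repr a) -(v_repr b) -(v_repr c) -!vM -![_ <= _]/(vle _ _) !vleE.
exact/val_le_mul/val_le_refl.
Qed.

End StandardValuation.

Definition ordered_group_iso (G H : porderZmodType) : Prop :=
  exists f : {additive G -> H}, bijective f /\ {mono f : x y / x <= y}.

(* Main.v *)
Require Import Defs.
From mathcomp Require Import all_boot all_order all_algebra.
From HB Require Import structures.
From mathcomp Require Import fraction generic_quotient ring lra.
From mathcomp Require Import boolp classical_sets functions cardinality.

Set Implicit Arguments.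
Unset Strict Implicit.
Unset Printing Implicit Defensive.

(** Sending a natural number [e] of the model [M] to the value of [2 ^ e]
    identifies the value group of [R(M)] with [M / F], where [F] is the group of
    finite elements: every element of [M] lies within a factor [2] of a power of
    [2], and [M / F] is divisible, so passing to the real closure adds no values.
    It remains to compare [M / F] and [N / F] as ordered groups.

    By Zorn's lemma take a maximal isomorphism between quotients [C / F] and
    [D / F] of convex subrings.  If neither subring is everything, choose [a]
    outside [C] and [b] outside [D]; the convex subrings generated by [a] and [b]
    are countable, and a back-and-forth argument extends the isomorphism to them.
    In one step, replace the new element [a] by [a - x], where [x] is a best
    approximation of [a] in the domain.  If the archimedean class of [a] is new,
    the image is chosen in the corresponding gap of classes, which exists because
    convex subrings are closed under square roots.  Otherwise [a] is determined
    by its real ratio to an element of the domain; this cut is coded in the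
    common standard system, hence realised in [N].  Cardinality finally forces
    the maximal isomorphism to be total and surjective. *)

Import Order.TTheory GRing.Theory Num.Theory.

Local Open Scope ring_scope.

(** * Definable predicates with parameters *)

(** The map from exponents to values reverses the order, in both models, and the two reversals
    cancel.

    The obstacle is that a best approximation may fail to exist when the domain has infinitely many
    archimedean classes, as the unions of chains in Zorn's lemma do. Convex subrings remove it.
    Every element of [C] is much less than every element outside [C], so all of [C] behaves as one
    class that is already matched, and a single back-and-forth only carries finitely many classes
    beyond it. Subtracting a best approximation keeps that number finite: for [u] in the domain and
    a nonzero integer [k], the element [u + k * a] is then never much less than [a], so adjoining
    [a] and closing under division adds at most one class.

    Multiplication makes room for new classes, as squares climb above a given class. The convex
    subring generated by [a] is countable because it is the union of the segments bounded by the
    standard powers of [a]. *)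

Fixpoint rename_term (r : nat -> nat) (t : term) : term :=
  match t with
  | Var n => Var (r n)
  | Zero => Zero
  | One => One
  | Add t1 t2 => Add (rename_term r t1) (rename_term r t2)
  | Mul t1 t2 => Mul (rename_term r t1) (rename_term r t2)
  end.

Definition lift_renaming (r : nat -> nat) (n : nat) : nat :=
  if n is m.+1 then (r m).+1 else 0%N.

Fixpoint rename (r : nat -> nat) (f : formula) : formula :=
  match f with
  | Eq t1 t2 => Eq (rename_term r t1) (rename_term r t2)
  | Lt t1 t2 => Lt (rename_term r t1) (rename_term r t2)
  | Bot => Bot
  | Imp f1 f2 => Imp (rename r f1) (rename r f2)
  | All f1 => All (rename (lift_renaming r) f1)
  end.

Lemma eval_rename (A : arith_structure) r (e : nat -> A) t :
  eval e (rename_term r t) = eval (e \o r) t.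
Proof. by elim: t => //= t1 -> t2 ->. Qed.

Lemma sat_rename (A : arith_structure) r (e : nat -> A) f :
  sat e (rename r f) <-> sat (e \o r) f.
Proof.
elim: f r e => /= [t1 t2|t1 t2||f1 IH1 f2 IH2|f IH] r e.
- by rewrite !eval_rename.
- by rewrite !eval_rename.
- by [].
- by rewrite IH1 IH2.
split=> fP x; have := fP x; rewrite IH;
  by congr (sat _ f); apply: funext => -[].
Qed.

(** Variables sit at even positions and parameters at odd ones, so that variables can be renamed and
    parameter streams merged independently of each other. *)
Definition interleave (T : Type) (e p : nat -> T) (n : nat) : T :=
  if odd n then p n./2 else e n./2.

Section Definability.
Variable M : realDomainType.
Implicit Types (e : nat -> nonneg M) (x y z a b : M).

Definition evalM e t : M := nonneg_val (@eval (nonneg_structure M) e t).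
Notation satM := (@sat (nonneg_structure M)).

Lemma nonneg_ge0 (u : nonneg M) : 0 <= nonneg_val u.
Proof. by case: u. Qed.

Definition to_nonneg x (x0 : 0 <= x) : nonneg M := Nonneg (x0 : x \is Num.nneg).

(* Terms may take negative values and mention arbitrary elements of [M] as
   parameters; these are stored at the odd positions of the environment. *)
Definition dterm (t : (nat -> nonneg M) -> M) : Prop :=
  exists t1 t2 p, forall e,
    t e = evalM (interleave e p) t1 - evalM (interleave e p) t2.

Definition dpred (D : (nat -> nonneg M) -> Prop) : Prop :=
  exists f p, forall e, satM (interleave e p) f <-> D e.

(** Closure under substitution of terms is built in, so that a predicate once proved definable
    serves as an atom of larger formulas, under quantifiers as well. *)
Definition definable (P : M -> Prop) : Prop :=
  forall t, dterm t -> dpred (fun e => P (t e)).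

Definition definable2 (P : M -> M -> Prop) : Prop :=
  forall t1 t2, dterm t1 -> dterm t2 -> dpred (fun e => P (t1 e) (t2 e)).

Lemma evalM_rename r e t : evalM e (rename_term r t) = evalM (e \o r) t.
Proof. by rewrite /evalM eval_rename. Qed.

(** Two formulas with parameters [p] and [q] are joined over the single stream [interleave p q]:
    [shareL] and [shareR] redirect the odd positions into it and fix the even ones. *)
Definition shareL n := if odd n then (n./2).*2.*2.+1 else n.
Definition shareR n := if odd n then ((n./2).*2.+1).*2.+1 else n.

Lemma interleave_shareL (T : Type) (e p q : nat -> T) :
  interleave e (interleave p q) \o shareL = interleave e p.
Proof.
apply: funext => n; rewrite /comp /interleave /shareL.
case: (boolP (odd n)) => [_|/negbTE ->//].
by rewrite /= odd_double uphalf_double /= odd_double half_double.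
Qed.

Lemma interleave_shareR (T : Type) (e p q : nat -> T) :
  interleave e (interleave p q) \o shareR = interleave e q.
Proof.
apply: funext => n; rewrite /comp /interleave /shareR.
case: (boolP (odd n)) => [_|/negbTE ->//].
by rewrite /= odd_double uphalf_double /= odd_double uphalf_double.
Qed.

Lemma dterm_var i : dterm (fun e => nonneg_val (e i)).
Proof.
exists (Var i.*2), Zero, (fun=> 0) => e.
by rewrite /evalM /= /interleave odd_double half_double subr0.
Qed.

Lemma dterm_const a : dterm (fun=> a).
Proof.
have p0 : 0 <= Num.max a 0 by rewrite le_max lexx orbT.
have n0 : 0 <= Num.max (- a) 0 by rewrite le_max lexx orbT.
exists (Var 1), (Var 3), (fun n => if n is 0%N then to_nonneg p0 else to_nonneg n0).
move=> e; rewrite /evalM /= /interleave /=.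
by case: (leP a 0) => a0; case: (leP (- a) 0) => a1; lra.
Qed.

Lemma dterm2 (op : M -> M -> M) t u :
  (forall t1 t2 u1 u2, exists s1 s2, forall e,
    op (evalM e t1 - evalM e t2) (evalM e u1 - evalM e u2)
      = evalM e s1 - evalM e s2) ->
  dterm t -> dterm u -> dterm (fun e => op (t e) (u e)).
Proof.
move=> opP [t1 [t2 [p tE]]] [u1 [u2 [q uE]]].
have [s1 [s2 sE]] := opP (rename_term shareL t1) (rename_term shareL t2)
  (rename_term shareR u1) (rename_term shareR u2).
exists s1, s2, (interleave p q) => e.
by rewrite -sE !evalM_rename interleave_shareL interleave_shareR tE uE.
Qed.

Lemma dtermD t u : dterm t -> dterm u -> dterm (fun e => t e + u e).
Proof.
apply: dterm2 => t1 t2 u1 u2; exists (Add t1 u1), (Add t2 u2) => e.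
by rewrite /evalM /=; ring.
Qed.

Lemma dtermB t u : dterm t -> dterm u -> dterm (fun e => t e - u e).
Proof.
apply: (dterm2 (op := fun x y => x - y)) => t1 t2 u1 u2.
exists (Add t1 u2), (Add t2 u1) => e.
by rewrite /evalM /=; ring.
Qed.

Lemma dtermN t : dterm t -> dterm (fun e => - t e).
Proof.
move=> [t1 [t2 [p tE]]]; exists t2, t1, p => e; rewrite tE; ring.
Qed.

Lemma dtermM t u : dterm t -> dterm u -> dterm (fun e => t e * u e).
Proof.
apply: dterm2 => t1 t2 u1 u2.
exists (Add (Mul t1 u1) (Mul t2 u2)), (Add (Mul t1 u2) (Mul t2 u1)) => e.
by rewrite /evalM /=; ring.
Qed.

Lemma dtermX t n : dterm t -> dterm (fun e => t e ^+ n).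
Proof.
move=> tP; elim: n => [|n IH]; first exact: dterm_const.
have := dtermM tP IH; congr dterm; apply: funext => e; by rewrite exprS.
Qed.

Lemma dtermMn t n : dterm t -> dterm (fun e => t e *+ n).
Proof.
move=> tP; have := dtermM (dterm_const n%:R) tP; congr dterm.
by apply: funext => e; rewrite mulr_natl.
Qed.

Lemma interleave_rename (T : Type) (r : nat -> nat) (e p : nat -> T) :
  interleave e p \o (fun n => if odd n then n else (r n./2).*2)
    = interleave (fun n => e (r n)) p.
Proof.
apply: funext => n; rewrite /comp /interleave.
by case: (boolP (odd n)) => [->|_] //; rewrite odd_double half_double.
Qed.

Lemma dterm_rename r t : dterm t -> dterm (fun e => t (fun n => e (r n))).
Proof.
move=> [t1 [t2 [p tE]]].
exists (rename_term (fun n => if odd n then n else (r n./2).*2) t1).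
exists (rename_term (fun n => if odd n then n else (r n./2).*2) t2), p => e.
by rewrite !evalM_rename interleave_rename tE.
Qed.

Lemma dpred_eq t u : dterm t -> dterm u -> dpred (fun e => t e = u e).
Proof.
move=> tP uP; have [s1 [s2 [p sE]]] := dtermB tP uP; exists (Eq s1 s2), p => e.
split=> /= [s12|tu]; first by apply: subr0_eq; rewrite sE /evalM s12 subrr.
by apply/val_inj/subr0_eq; rewrite -[LHS]/(_ - _) -sE tu subrr.
Qed.

Lemma dpred_lt t u : dterm t -> dterm u -> dpred (fun e => t e < u e).
Proof.
move=> tP uP; have [s1 [s2 [p sE]]] := dtermB tP uP; exists (Lt s1 s2), p => e.
by rewrite /= -[t e < u e]subr_lt0 sE subr_lt0.
Qed.

Lemma dpred_ext (D E : (nat -> nonneg M) -> Prop) :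
  dpred D -> (forall e, D e <-> E e) -> dpred E.
Proof. by move=> [f [p fP]] DE; exists f, p => e; rewrite fP DE. Qed.

Lemma dpred_imp D E : dpred D -> dpred E -> dpred (fun e => D e -> E e).
Proof.
move=> [f [p fP]] [g [q gP]].
exists (Imp (rename shareL f) (rename shareR g)), (interleave p q) => e /=.
by rewrite !sat_rename interleave_shareL interleave_shareR fP gP.
Qed.

Lemma dpred_false : dpred (fun=> False).
Proof. by exists Bot, (fun=> 0). Qed.

Lemma dpred_not D : dpred D -> dpred (fun e => ~ D e).
Proof. by move=> Dd; apply: dpred_imp Dd dpred_false. Qed.

Lemma dpred_le t u : dterm t -> dterm u -> dpred (fun e => t e <= u e).
Proof.
move=> tP uP; apply: dpred_ext (dpred_not (dpred_lt uP tP)) _ => e.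
by rewrite leNgt; split=> [/negP|/negP].
Qed.

Lemma dpred_const (Q : Prop) : dpred (fun=> Q).
Proof.
have [q|nq] := pselect Q.
  by apply: dpred_ext (dpred_not dpred_false) _ => e; split=> // _ [].
by apply: dpred_ext dpred_false _ => e; split=> [[]|/nq].
Qed.

Lemma dpred_and D E : dpred D -> dpred E -> dpred (fun e => D e /\ E e).
Proof.
move=> Dd Ed.
apply: dpred_ext (dpred_not (dpred_imp Dd (dpred_not Ed))) _ => e.
split=> [nDE|[d ed]]; last by move/(_ d).
by split; apply: contrapT => n; apply: nDE => // d; case: (n d).
Qed.

Lemma dpred_or D E : dpred D -> dpred E -> dpred (fun e => D e \/ E e).
Proof.
move=> Dd Ed; apply: dpred_ext (dpred_imp (dpred_not Dd) Ed) _ => e.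
split=> [nDE|[d|ed]]; [|by move/(_ d)|by []].
by have [d|/nDE] := pselect (D e); [left|right].
Qed.

Lemma dpred_iff D E : dpred D -> dpred E -> dpred (fun e => D e <-> E e).
Proof. by move=> Dd Ed; apply: dpred_and; apply: dpred_imp. Qed.

Lemma dpred_all (P : M -> (nat -> nonneg M) -> Prop) :
  dpred (fun e => P (nonneg_val (e 0%N)) (fun n => e n.+1)) ->
  dpred (fun e => forall x, 0 <= x -> P x e).
Proof.
move=> [f [p fP]].
(* Under the binder the old environment is shifted by one. Parameters at odd positions move up;
   variable [m + 1], at position [2m + 2], is the old variable [m], now found at [2m + 1]. *)
pose s n := if odd n then n.+1 else if n is m.+2 then m.+1 else 0%N.
exists (All (rename s f)), p => e.
have E (x : nonneg_structure M) :
    env_cons x (interleave e p) \o s = interleave (env_cons x e) p.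
  apply: funext => n; rewrite /comp /s.
  case: (boolP (odd n)) => [nodd|]; first by rewrite /= /interleave nodd.
  case: n => [|[|n]] //= ; rewrite negbK => /negbTE nev.
  by rewrite /interleave /= nev.
split=> /= [fA x x0|PA x].
  by have := fA (to_nonneg x0); rewrite sat_rename E fP.
by rewrite sat_rename E fP /=; apply: PA; apply: nonneg_ge0.
Qed.

Lemma dpred_ex (P : M -> (nat -> nonneg M) -> Prop) :
  dpred (fun e => P (nonneg_val (e 0%N)) (fun n => e n.+1)) ->
  dpred (fun e => exists x, 0 <= x /\ P x e).
Proof.
move=> Pd.
apply: dpred_ext (dpred_not (dpred_all (P := fun x e => ~ P x e) (dpred_not Pd))) _.
move=> e; split=> [nP|[x [x0 Px]] nP]; last exact: nP Px.
by apply: contrapT => nE; apply: nP => x x0 Px; apply: nE; exists x.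
Qed.

(** Object quantifiers range over nonnegative elements, so a signed element is quantified as a
    difference of two of them. *)
Lemma dpred_exM (P : M -> (nat -> nonneg M) -> Prop) :
  dpred (fun e => P (nonneg_val (e 1%N) - nonneg_val (e 0%N)) (fun n => e n.+2)) ->
  dpred (fun e => exists x, P x e).
Proof.
move=> Pd; apply: (dpred_ext
  (D := fun e => exists x, 0 <= x /\ exists y, 0 <= y /\ P (x - y) e)).
  by apply: dpred_ex; apply: dpred_ex.
move=> e; split=> [[x [x0 [y [y0 Pxy]]]]|[x Px]]; first by exists (x - y).
have [x0|x0] := leP 0 x; first by exists x; split=> //; exists 0; rewrite subr0.
by exists 0; split=> //; exists (- x); rewrite sub0r opprK oppr_ge0 ltW.
Qed.

End Definability.

(** A term fixed outside some quantifiers occurs under them with its environment shifted by their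
    number. *)
Ltac dfn_shift :=
  match goal with
  | H : dterm ?t |- dterm _ =>
    first [ exact H
          | exact (dterm_rename S H)
          | exact (dterm_rename (fun n => n.+2) H)
          | exact (dterm_rename (fun n => n.+3) H)
          | exact (dterm_rename (fun n => n.+4) H)
          | exact (dterm_rename (fun n => n.+4.+1) H)
          | exact (dterm_rename (fun n => n.+4.+2) H)
          | exact (dterm_rename (fun n => n.+4.+3) H)
          | exact (dterm_rename (fun n => n.+4.+4) H)
          | exact (dterm_rename (fun n => n.+4.+4.+1) H)
          | exact (dterm_rename (fun n => n.+4.+4.+2) H) ]
  end.

(** Goals are taken apart by syntactic shape. This is why statements are restated before an
    induction with guards [0 <= x] and nested binary conjunctions. [dpred_exM] comes after
    [dpred_ex], to catch unguarded quantifiers. *)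
Ltac dfn_step := first
  [ apply dterm_const | apply dpred_const | apply dterm_var | dfn_shift
  | match goal with H : definable ?P |- dpred _ => apply H
                  | H : definable2 ?P |- dpred _ => apply H end
  | apply dpred_eq | apply dpred_lt | apply dpred_le
  | apply dpred_all; cbv beta | apply dpred_ex; cbv beta
  | apply dpred_iff | apply dpred_and | apply dpred_or | apply dpred_not
  | apply dpred_imp
  | apply dpred_exM; cbv beta
  | apply dtermB | apply dtermD | apply dtermM | apply dtermN | apply dtermX
  | apply dtermMn ].

Ltac dfn := intros; repeat dfn_step.

(** * Arithmetic in models of Peano arithmetic *)

Definition posinf (R : numDomainType) (x : R) : Prop := forall n : nat, n%:R < x.

Definition fin (R : numDomainType) (x : R) : Prop := exists n : nat, `|x| <= n%:R.

Section Arithmetic.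
Variable M : realDomainType.
Hypothesis paM : PA_model (nonneg_structure M).
Implicit Types (x y z a b c d : M) (P : M -> Prop).

Lemma definable_ind P : definable P -> P 0 ->
  (forall x, 0 <= x -> P x -> P (x + 1)) -> forall x, 0 <= x -> P x.
Proof.
move=> Pd P0 PS x x0; have [f [p fP]] := Pd _ (dterm_var M 0).
pose g n := interleave (env_cons (0 : nonneg_structure M) (fun=> 0)) p n.+1.
have E (u : nonneg_structure M) :
    env_cons u g = interleave (env_cons u (fun=> 0)) p.
  apply: funext => -[|n] //; rewrite /g /= /interleave.
  by case: ifP => // n1; case: n n1 => [|n].
have satP (u : nonneg_structure M) : sat (env_cons u g) f <-> P (nonneg_val u).
  by rewrite E fP.
have := @pa_induction _ paM f g; move/(_ _ _ (to_nonneg x0)).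
rewrite !satP; apply=> // u; rewrite !satP; apply: PS; exact: nonneg_ge0.
Qed.

Lemma discrete x : 0 < x -> 1 <= x.
Proof.
move=> x0; suff: x = 0 \/ 1 <= x by case=> // xE; rewrite xE ltxx in x0.
have : 0 <= x by apply: ltW.
apply: (definable_ind (P := fun x => x = 0 \/ 1 <= x)); first by move=> t ?; dfn.
  by left.
by move=> y y0 _; right; lra.
Qed.

Lemma discreteD1 x y : x < y -> x + 1 <= y.
Proof. by move=> xy; have := @discrete (y - x); rewrite subr_gt0 => /(_ xy); lra. Qed.

Lemma discreteS x y : x < y + 1 -> x <= y.
Proof. by move=> xy; rewrite leNgt; apply/negP => /discreteD1; lra. Qed.

Lemma definable_min P : definable P -> (exists x, 0 <= x /\ P x) ->
  exists x, [/\ 0 <= x, P x & forall y, 0 <= y -> y < x -> ~ P y].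
Proof.
move=> Pd [x [x0 Px]]; apply: contrapT => nE.
suff: forall y, 0 <= y -> y <= x -> ~ P y by move/(_ x x0 (lexx x)).
apply: (definable_ind (P := fun x => forall y, 0 <= y -> y <= x -> ~ P y)) x0.
- by move=> t ?; dfn.
- move=> y y0 y0' Py; apply: nE; exists y; split=> // z z0 zy; lra.
move=> z z0 IH y y0 yz Py; apply: nE; exists y; split=> // t t0 ty.
by apply: IH => //; apply: discreteS; lra.
Qed.

Lemma fin_nat x n : 0 <= x -> x <= n%:R -> exists2 k, x = k%:R & (k <= n)%N.
Proof.
elim: n => [|n IH] x0 xn; first by exists 0%N => //; apply/le_anti/andP.
have [/IH[//|k -> kn]|nx] := leP x n%:R; first by exists k => //; apply: leqW.
exists n.+1 => //; apply/le_anti; rewrite xn /= -natr1.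
exact: discreteD1.
Qed.

Lemma posinfN x : 0 <= x -> ~ posinf x -> exists k, x = k%:R.
Proof.
move=> x0 /existsNP[n /negP]; rewrite -leNgt => /(fin_nat x0)[k ->].
by exists k.
Qed.

(** If [P] failed at every infinite element, it would define the standard numbers, which are closed
    under successor, and induction would put the infinite [w] among them. *)
Lemma overspill P : definable P -> (exists x : M, posinf x) ->
  (forall n, P n%:R) -> exists x, [/\ posinf x, 0 <= x & P x].
Proof.
move=> Pd [w winf] Pn; apply: contrapT => nE.
suff all y : 0 <= y -> P y.
  by apply: nE; exists w; split=> //; [apply/ltW/(winf 0)|apply/all/ltW/(winf 0)].
apply: definable_ind => // [|{}y y0 Py]; first exact: (Pn 0).
have [yinf|/(posinfN y0)[k ->]] := pselect (posinf y).
  by case: nE; exists y.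
by rewrite natr1.
Qed.

Lemma euclid x d : 0 <= x -> 0 < d ->
  exists q r, [/\ 0 <= q, 0 <= r, r < d & x = q * d + r].
Proof.
move=> x0 d0; suff: exists q, 0 <= q /\ exists r, 0 <= r /\ (r < d /\ x = q * d + r).
  by move=> [q [q0 [r [r0 [rd xE]]]]]; exists q, r.
move: x x0; apply: definable_ind => [t ?||x x0 [q [q0 [r [r0 [rd xE]]]]]].
- by dfn.
- by exists 0; split=> //; exists 0; split=> //; rewrite mul0r addr0.
have [rd1|rd1] := ltP (r + 1) d.
  by exists q; split=> //; exists (r + 1); split; [lra|rewrite xE; split; lra].
have {}rd1 : r + 1 = d by apply/le_anti; rewrite rd1 discreteD1.
exists (q + 1); split; first lra; exists 0; do 2!split=> //.
by rewrite xE -rd1; ring.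
Qed.

Lemma isqrt x : 0 <= x -> exists2 c, 0 <= c & c * c <= x /\ x < (c + 1) * (c + 1).
Proof.
move=> x0; suff: exists c, 0 <= c /\ (c * c <= x /\ x < (c + 1) * (c + 1)).
  by move=> [c [c0 cE]]; exists c.
move: x x0; apply: definable_ind => [t ?||x x0 [c [c0 [cx xc]]]].
- by dfn.
- by exists 0; split=> //; rewrite mul0r add0r mul1r ltr01.
have [xc1|xc1] := ltP (x + 1) ((c + 1) * (c + 1)).
  by exists c; split=> //; split=> //; lra.
exists (c + 1); split; first lra; split=> //.
have := discreteD1 xc; nra.
Qed.

End Arithmetic.

(** * Coding and recursion *)

Definition divides (R : numDomainType) (m c : R) : Prop :=
  exists q, 0 <= q /\ c = q * m.

(** Coprimality in Bezout form with signed coefficients; it is multiplicative in [u] by a polynomial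
    identity. *)
Definition unit_mod (R : numDomainType) (u m : R) : Prop :=
  exists x y, u * x = 1 + m * y.

(** The moduli of Gödel's beta function. *)
Definition beta_modulus (R : numDomainType) (d k : R) : R := 1 + (k + 1) * d.

(** With [s = i + x] and [0 <= i <= s], the value lies between [s ^ 2] and [(s + 1) ^ 2], the latter
    excluded; it determines [s], then [i]. *)
Definition pairing (R : numDomainType) (i x : R) : R := (i + x) ^+ 2 + i.

Lemma pairing_inj (R : realDomainType) (i x j y : R) :
  0 <= i -> 0 <= x -> 0 <= j -> 0 <= y ->
  (forall z t : R, z < t -> z + 1 <= t) ->
  pairing i x = pairing j y -> i = j /\ x = y.
Proof.
rewrite /pairing => i0 x0 j0 y0 disc ij.
suff s : i + x = j + y by move: ij; rewrite s => ij; split; lra.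
by case: (ltgtP (i + x) (j + y)) => // /disc; nra.
Qed.

Lemma unit_modM (R : numDomainType) (u v m : R) :
  unit_mod u m -> unit_mod v m -> unit_mod (u * v) m.
Proof.
move=> [x [y ux]] [z [t vz]]; exists (x * z), (y + t + m * y * t).
by rewrite mulrACA ux vz; ring.
Qed.

(* With [m_i = 1 + (i + 1) d], one has [m_j = m_i + (j - i) d], and if
   [d = (j - i) q] then [(j - i) d q (i + 1)^2 = (m_i - 1)^2], which is [1]
   modulo [m_i]. *)
Lemma unit_mod_beta (R : numDomainType) (d i j q : R) : d = (j - i) * q ->
  unit_mod (beta_modulus d j) (beta_modulus d i).
Proof.
move=> dE; exists (q * (i + 1) ^+ 2).
exists (q * (i + 1) ^+ 2 + beta_modulus d i - 2%:R).
by rewrite /beta_modulus [in X in (1 + _ * X) * _]dE [in X in _ = X]dE; ring.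
Qed.

Section Coding.
Variable M : realDomainType.
Hypothesis paM : PA_model (nonneg_structure M).
Implicit Types (x y z a b c d i j k n q : M) (P : M -> Prop).

Lemma definable2_divides : definable2 (@divides M).
Proof. by move=> t u ? ?; rewrite /divides; dfn. Qed.

Lemma definable2_unit_mod : definable2 (@unit_mod M).
Proof. by move=> t u ? ?; rewrite /unit_mod; dfn. Qed.

(** Plays the role of the factorial of [n], at a point where recursion inside [M] is still to be
    built. *)
Lemma common_multiple n : 0 <= n -> exists d : M, 0 < d /\
  forall i, 1 <= i -> i <= n -> divides i d.
Proof.
move=> n0; suff: exists d : M, 0 <= d /\ (0 < d /\
    forall i, 0 <= i -> 1 <= i -> i <= n -> divides i d).
  by move=> [d [_ [d0 dP]]]; exists d; split=> // i i1; apply: dP => //; lra.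
have ? := definable2_divides.
move: n n0; apply: (definable_ind paM) => [t ?||n n0 [d [d0 [d0' dP]]]].
- by dfn.
- by exists 1; do 2!split=> //; move=> i i0 i1 i0'; lra.
exists (d * (n + 1)); split; first nra; split; first nra; move=> i i0 i1.
have [/(discreteS paM) i_n _|n_i in1] := ltP i (n + 1).
  have [q [q0 ->]] := dP i i0 i1 i_n.
  by exists (q * (n + 1)); split; [nra|ring].
by exists d; split=> //; congr (_ * _); lra.
Qed.

Lemma unit_mod_divides c m : 1 < m -> unit_mod c m -> ~ divides m c.
Proof.
move=> m1 [x [y cx]] [q [_ cE]].
have mt : m * (q * x - y) = 1 by rewrite mulrBr mulrA [m * q]mulrC -cE cx; ring.
have [t0|t0] := ltP 0 (q * x - y); last nra.
by have := discrete paM t0; nra.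
Qed.

(** The code [c] is in effect the product of the moduli of those [k <= n] with [P k]. Induction on
    [K] builds it through two properties: the moduli already multiplied in divide it, and it is a
    unit modulo all the others. *)
Lemma comprehension P n : definable P -> 0 <= n -> exists c d : M,
  forall k, 0 <= k -> k <= n -> (P k <-> divides (beta_modulus d k) c).
Proof.
move=> Pd n0; have [d [d0 dP]] := common_multiple n0.
have [? ?] := (definable2_divides, definable2_unit_mod).
have coprime i j : 0 <= i -> i <= n -> 0 <= j -> j <= n -> i <> j ->
    unit_mod (beta_modulus d j) (beta_modulus d i).
  move=> i0 i_n j0 j_n; case: (ltgtP i j) => // ij _.
    have [q [_ dE]] : divides (j - i) d.
      by apply: dP; [apply: (discrete paM)|]; lra.
    by apply: (unit_mod_beta (q := q)); rewrite dE mulrC.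
  have [q [_ dE]] : divides (i - j) d.
    by apply: dP; [apply: (discrete paM)|]; lra.
  by apply: (unit_mod_beta (q := - q)); rewrite dE; ring.
suff partial K : 0 <= K -> K <= n + 1 -> exists c, 0 <= c /\
    ((forall k, 0 <= k -> k < K -> P k -> divides (beta_modulus d k) c) /\
     (forall j, 0 <= j -> j <= n -> K <= j \/ ~ P j ->
        unit_mod c (beta_modulus d j))).
  have [||c [c0 [cP cNP]]] := partial (n + 1); [lra|lra|].
  exists c, d => k k0 kn; split=> [Pk|dvdk]; first by apply: cP => //; lra.
  apply: contrapT => nPk; apply: unit_mod_divides dvdk; last by apply: cNP; auto.
  by rewrite /beta_modulus; nra.
move: K; apply: (definable_ind paM) => [t ?||K K0 IH Kn].
- by rewrite /beta_modulus; dfn.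
- move=> _; exists 1; split=> //; split=> [k k0|j j0 jn _]; first lra.
  by exists 1, 0; ring.
have [|c [c0 [cP cU]]] := IH; first lra.
have [PK|nPK] := pselect (P K); last first.
  exists c; split=> //; split=> [k k0 /(discreteS paM) kK Pk|j j0 jn jP].
    apply: cP => //; rewrite lt_neqAle kK andbT; apply/eqP => kE.
    by apply: nPK; rewrite -kE.
  by apply: cU => //; case: jP => [jK|]; [left; lra|right].
have m0 : 0 <= beta_modulus d K by rewrite /beta_modulus; nra.
exists (c * beta_modulus d K); split; first exact: mulr_ge0.
split=> [k k0 /(discreteS paM) kK Pk|j j0 jn jP].
  have [ltkK|geKk] := ltP k K.
    have [q [q0 ->]] := cP k k0 ltkK Pk.
    by exists (q * beta_modulus d K); split; [exact: mulr_ge0|ring].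
  have -> : k = K by lra.
  by exists c; split.
apply: unit_modM; first by apply: cU => //; case: jP => [jK|]; [left; lra|right].
by apply: coprime => //; [lra|move=> jE; case: jP; [lra|rewrite jE]].
Qed.

Section Recursion.
Variables (F : M -> M -> Prop) (a : M).
Hypothesis Fd : definable2 F.
Hypothesis a0 : 0 <= a.
Hypothesis F_total : forall x, 0 <= x -> exists2 y, 0 <= y & F x y.
Hypothesis F_fun : forall x y z, F x y -> F x z -> y = z.

(** The bound [b] cuts off the indices beyond the range in which [comprehension] controls
    divisibility. *)
Definition in_code b c d i x : Prop :=
  pairing i x <= b /\ divides (beta_modulus d (pairing i x)) c.

Definition history b c d n : Prop :=
  in_code b c d 0 a /\ ((forall x, 0 <= x -> in_code b c d 0 x -> x = a) /\
  forall i, 0 <= i -> i < n -> forall x, 0 <= x -> in_code b c d i x ->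
    forall y, 0 <= y -> (in_code b c d (i + 1) y <-> F x y)).

Definition rec_graph n y : Prop := exists b c d, history b c d n /\ in_code b c d n y.

Lemma definable2_rec_graph : definable2 rec_graph.
Proof.
have ? := definable2_divides; move=> t u ? ?.
by rewrite /rec_graph /history /in_code /pairing /beta_modulus; dfn.
Qed.

Lemma history_unique b c d b' c' d' n : history b c d n -> history b' c' d' n ->
  forall i, 0 <= i -> i <= n -> exists x, 0 <= x /\ (in_code b c d i x /\
    (in_code b' c' d' i x /\
     forall y, 0 <= y -> in_code b c d i y \/ in_code b' c' d' i y -> y = x)).
Proof.
move=> [h0 [h0u hS]] [h'0 [h'0u h'S]]; have ? := definable2_divides.
apply: (definable_ind paM) => [t ?|_|i i0 IH i1n].
- by rewrite /in_code /pairing /beta_modulus; dfn.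
- by exists a; do 3!split=> //; move=> y y0 [/h0u|/h'0u]; apply.
have [|x [x0 [hx [h'x _]]]] := IH; first lra.
have [y y0 Fxy] := F_total x0; have i_n : i < n by lra.
have hSi := hS i i0 i_n x x0 hx; have h'Si := h'S i i0 i_n x x0 h'x.
exists y; split=> //; split; first by rewrite hSi.
split=> [|z z0]; first by rewrite h'Si.
by rewrite (hSi z z0) (h'Si z z0) => -[] Fxz; apply: F_fun Fxz Fxy.
Qed.

Lemma rec_graph_fun n y z : 0 <= n -> 0 <= y -> 0 <= z ->
  rec_graph n y -> rec_graph n z -> y = z.
Proof.
move=> n0 y0 z0 [b [c [d [h hy]]]] [b' [c' [d' [h' h'z]]]].
have [x [x0 [_ [_ xu]]]] := history_unique h h' n0 (lexx n).
by rewrite (xu y y0 (or_introl hy)) (xu z z0 (or_intror h'z)).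
Qed.

Lemma pairing_ge0 (i x : M) : 0 <= i -> 0 <= x -> 0 <= pairing i x.
Proof. by rewrite /pairing; nra. Qed.

Lemma pairingI (i x j y : M) : 0 <= i -> 0 <= x -> 0 <= j -> 0 <= y ->
  pairing i x = pairing j y -> i = j /\ x = y.
Proof. by move=> *; apply: pairing_inj => // z t; apply: discreteD1. Qed.

Lemma rec_graph0 : rec_graph 0 a.
Proof.
have Pd : definable (fun k => k = pairing 0 a) by move=> t ?; dfn.
have p0 := pairing_ge0 (lexx 0) a0.
have [c [d cdP]] := comprehension Pd p0.
have inE x : 0 <= x -> (in_code (pairing 0 a) c d 0 x <-> x = a).
  move=> x0; rewrite /in_code; split=> [[le_b]|->]; last by rewrite -cdP.
  by rewrite -cdP ?pairing_ge0 // => /pairingI[].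
exists (pairing 0 a), c, d; split; last by rewrite inE.
by split; [rewrite inE|split=> [x x0|i i0 ?]; [rewrite inE|lra]].
Qed.

Lemma rec_graphS n x y : 0 <= n -> 0 <= x -> 0 <= y ->
  rec_graph n x -> F x y -> rec_graph (n + 1) y.
Proof.
move=> n0 x0 y0 [b [c [d [h hx]]]] Fxy; have ? := definable2_divides.
have xu z : 0 <= z -> in_code b c d n z -> z = x.
  by move=> z0 hz; apply: rec_graph_fun n0 z0 x0 _ _; exists b, c, d.
(* The old code may contain stray pairs of index [n + 1], which would spoil uniqueness there. Only
   indices up to [n] are kept, and one new pair is added. *)
pose P k := k <= b /\ divides (beta_modulus d k) c /\
  (exists i, 0 <= i /\ (i <= n /\ exists z, 0 <= z /\ k = pairing i z)) \/
  k = pairing (n + 1) y.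
have Pd : definable P by move=> t ?; rewrite /P /pairing /beta_modulus; dfn.
have b0 : 0 <= b by case: hx => + _; apply: le_trans; apply: pairing_ge0.
have n10 : 0 <= n + 1 by lra.
have p0 := pairing_ge0 n10 y0.
have bp0 : 0 <= b + pairing (n + 1) y by lra.
have [c' [d' cdP]] := comprehension Pd bp0.
set b' := b + _ in bp0 cdP.
have inl i z : 0 <= i -> 0 <= z -> i <= n ->
    (in_code b' c' d' i z <-> in_code b c d i z).
  move=> i0 z0 i_n; rewrite {1}/in_code.
  split=> [[le_b]|[le_b hz]].
    rewrite -cdP ?pairing_ge0 // => -[[? [? _]] //|/pairingI[] //]; lra.
  have le_b' : pairing i z <= b' by rewrite /b'; lra.
  split=> //; rewrite -cdP ?pairing_ge0 //; left; do 2!split=> //.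
  by exists i; split=> //; split=> //; exists z.
have inr z : 0 <= z -> (in_code b' c' d' (n + 1) z <-> z = y).
  move=> z0; split=> [[le_b]|->].
    rewrite -cdP ?pairing_ge0 // => -[[_ [_ [i [i0 [i_n [t [t0]]]]]]]|].
      by move/pairingI => [] //; lra.
    by move/pairingI => [].
  have le_b' : pairing (n + 1) y <= b' by rewrite /b'; lra.
  by split=> //; rewrite -cdP //; right.
exists b', c', d'; split; last by rewrite inr.
case: h => h0 [h0u hS]; split; first by rewrite inl.
split=> [z z0|i i0 i_n z z0]; first by rewrite inl //; apply: h0u.
have {}i_n : i <= n by apply: (discreteS paM).
rewrite inl // => hz t t0; have [ltin|gein] := ltP i n.
  rewrite inl //; [exact: hS|lra|exact: discreteD1].
have iE : i = n by lra.
move: hz; rewrite iE => /(xu _ z0) ->; rewrite inr //.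
by split=> [->|/(F_fun Fxy)->].
Qed.

Lemma rec_graph_total n : 0 <= n -> exists2 y, 0 <= y & rec_graph n y.
Proof.
move=> n0; have ? := definable2_rec_graph.
suff: exists y, 0 <= y /\ rec_graph n y by move=> [y []]; exists y.
move: n n0; apply: (definable_ind paM) => [t ?||n n0 [x [x0 xP]]].
- by dfn.
- by exists a; split=> //; apply: rec_graph0.
have [y y0 Fxy] := F_total x0.
by exists y; split=> //; apply: rec_graphS xP Fxy.
Qed.

End Recursion.
End Coding.

(** * Exponentiation, standard systems and transfer of cuts *)

Section Exponential.
Variable M : realDomainType.
Hypothesis paM : PA_model (nonneg_structure M).
Implicit Types (x y z a b c d i j k n q : M) (P : M -> Prop).

(** Recursion on doubling. [E] comes from choice while definability is available for the graph [G],
    so each induction proves a statement about [G], which is then read off for [E]. *)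
Lemma exp2_exists : exists E : M -> M,
  [/\ E 0 = 1, forall n, 0 <= n -> 0 < E n,
      forall m n, 0 <= m -> 0 <= n -> E (m + n) = E m * E n,
      E 1 = 2%:R
    & forall a, 0 < a -> exists2 n, 0 <= n & E n <= a /\ a < 2%:R * E n].
Proof.
pose F x y := y = 2%:R * x.
have Fd : definable2 F by move=> t u ? ?; rewrite /F; dfn.
have a0 : 0 <= 1 :> M by [].
have Ft x : 0 <= x -> exists2 y, 0 <= y & F x y.
  by move=> x0; exists (2%:R * x) => //; rewrite mulr_ge0.
have Ff x y z : F x y -> F x z -> y = z by rewrite /F => -> ->.
pose G := rec_graph F 1.
have Gd : definable2 G by apply: definable2_rec_graph.
have G0 : G 0 1 := rec_graph0 paM F a0.
have GS n y : 0 <= n -> 0 <= y -> G n y -> G (n + 1) (2%:R * y).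
  move=> n0 y0 Gny; apply: (rec_graphS paM a0 Ft Ff n0 y0 _ Gny) => //.
  by rewrite mulr_ge0.
have Gf n y z : 0 <= n -> 0 <= y -> 0 <= z -> G n y -> G n z -> y = z.
  exact: (rec_graph_fun paM a0 Ft Ff).
have /choice[E EP] n : exists y, 0 <= n -> 0 <= y /\ G n y.
  have [n0|n0] := boolP (0 <= n); last by exists 0.
  by have [y y0 Gy] := rec_graph_total paM Fd a0 Ft Ff n0; exists y.
have E0 : E 0 = 1 by have [? ?] := EP 0 (lexx 0); apply: (Gf 0).
have ES n : 0 <= n -> E (n + 1) = 2%:R * E n.
  move=> n0; have n1 : 0 <= n + 1 by lra.
  have [? ?] := EP n n0; have [? ?] := EP _ n1.
  by apply: (Gf (n + 1)) => //; [rewrite mulr_ge0|apply: GS].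
have Egt0 n : 0 <= n -> 0 < E n.
  move=> n0; suff: forall y, 0 <= y -> G n y -> 0 < y.
    by have [? ?] := EP n n0; apply.
  move: n n0; apply: (definable_ind paM) => [t ?|y y0 Gy|n n0 IH y y0 Gy].
  - by dfn.
  - by rewrite (Gf 0 y 1).
  have [En0 En] := EP n n0; have n1 : 0 <= n + 1 by lra.
  rewrite (Gf _ _ _ n1 y0 _ Gy (GS _ _ n0 En0 En)) ?mulr_ge0 //.
  by have := IH _ En0 En; lra.
have ED m n : 0 <= m -> 0 <= n -> E (m + n) = E m * E n.
  move=> m0 n0; suff: forall y, 0 <= y -> forall z, 0 <= z ->
      forall w, 0 <= w -> G m y -> G n z -> G (m + n) w -> w = y * z.
    have [? ?] := EP m m0; have [? ?] := EP n n0.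
    by have [|? ?] := EP (m + n); [lra|apply].
  move: n n0; apply: (definable_ind paM) => [t ?||n n0 IH].
  - by dfn.
  - move=> y y0 z z0 w w0 Gy Gz Gw; rewrite addr0 in Gw.
    by rewrite (Gf _ _ _ _ z0 _ Gz G0) // mulr1; apply: (Gf m).
  move=> y y0 z z0 w w0 Gy Gz Gw.
  have [? ?] := EP n n0; have mn0 : 0 <= m + n by lra.
  have mn1 : 0 <= m + n + 1 by lra.
  have n1 : 0 <= n + 1 by lra.
  have [? ?] := EP _ mn0; rewrite addrA in Gw.
  rewrite (Gf _ _ (2%:R * E n) n1 z0 _ Gz) ?mulr_ge0 //; last exact: GS.
  rewrite (Gf _ _ (2%:R * E (m + n)) mn1 w0 _ Gw) ?mulr_ge0 //; last exact: GS.
  by rewrite (IH y y0 (E n) _ (E (m + n))) //; ring.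
exists E; split=> //; first by have := ES 0 (lexx 0); rewrite add0r E0 mulr1.
move=> a a0'; have : 0 <= a - 1 by have := discrete paM a0'; lra.
suff log b : 0 <= b -> exists n, 0 <= n /\ exists y, 0 <= y /\
    (G n y /\ (y <= b + 1 /\ b + 1 < 2%:R * y)).
  move=> /log[n [n0 [y [y0 [Gy]]]]]; rewrite subrK => le_y.
  by exists n => //; have [? ?] := EP n n0; rewrite (Gf n (E n) y).
move: b; apply: (definable_ind paM) => [t ?||b b0 [n [n0 [y [y0 [Gy [yb by2]]]]]]].
- by dfn.
- by exists 0; split=> //; exists 1; do 2!split=> //; rewrite add0r; split=> //; lra.
have [lt2y|ge2y] := ltP (b + 1 + 1) (2%:R * y).
  by exists n; split=> //; exists y; do 2!split=> //; split=> //; lra.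
exists (n + 1); split; first lra; exists (2%:R * y); split; first lra.
by split; [apply: GS|split=> //; have := discreteD1 paM by2; lra].
Qed.

End Exponential.

(** * Primes inside the model and the sets coded by them *)

Section StandardSystem.
Variable M : realDomainType.
Hypothesis paM : PA_model (nonneg_structure M).
Implicit Types (x y z a b c d i j q : M) (P : M -> Prop).

Lemma divides_nat k l : divides k%:R (l%:R : M) <-> (k %| l)%N.
Proof.
split=> [[q [q0 lE]]|/dvdnP[q ->]]; last by exists q%:R; rewrite natrM.
have [k0|k0] := posnP k.
  by move/eqP: lE; rewrite k0 mulr0 pnatr_eq0 => /eqP ->.
have k1 : 1 <= k%:R :> M by rewrite ler1n.
have [|m qE _] := fin_nat paM (n := l) q0; first by rewrite lE; nra.
by move/eqP: lE; rewrite qE -natrM eqr_nat => /eqP ->; apply: dvdn_mull.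
Qed.

Definition nonstd_prime y : Prop :=
  1 < y /\ forall u : M, 0 <= u -> forall v : M, 0 <= v -> y = u * v -> u = 1 \/ v = 1.

Lemma nonstd_prime_nat k : nonstd_prime k%:R <-> prime k.
Proof.
rewrite /nonstd_prime ltr1n; split=> [[k1 kP]|k_pr].
  apply/primeP; split=> // d /dvdnP[q kE].
  have := kP q%:R (ler0n _ _) d%:R (ler0n _ _).
  rewrite -natrM -kE => /(_ erefl)[] /eqP; rewrite pnatr_eq1 => /eqP E.
    by rewrite kE E mul1n eqxx orbT.
  by rewrite E.
split=> [|u u0 v v0 kE]; first exact: prime_gt1.
have k0 : 0 < k%:R :> M by rewrite ltr0n prime_gt0.
have u1 : 1 <= u by apply: (discrete paM); rewrite lt_neqAle u0 andbT;
  apply/eqP => u0'; move: k0; rewrite kE -u0' mul0r ltxx.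
have v1 : 1 <= v by apply: (discrete paM); rewrite lt_neqAle v0 andbT;
  apply/eqP => v0'; move: k0; rewrite kE -v0' mulr0 ltxx.
have [|m uE _] := fin_nat paM (n := k) u0; first by rewrite kE; nra.
have [|n vE _] := fin_nat paM (n := k) v0; first by rewrite kE; nra.
move/eqP: kE; rewrite uE vE -natrM eqr_nat => /eqP kE.
have /primeP[_ /(_ m)] := k_pr; rewrite kE dvdn_mulr // => /(_ isT) /orP[]/eqP mE.
  by left; rewrite mE.
right; move/eqP: mE; rewrite -{1}[m]muln1 eqn_pmul2l => [/eqP <- //|].
by move: (prime_gt0 k_pr); rewrite kE muln_gt0 => /andP[].
Qed.

(** The default value [0] makes the relation total, as the recursion requires. *)
Definition prime_after x y : Prop :=
  0 <= y /\ (x < y /\ (nonstd_prime y /\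
     forall z, 0 <= z -> x < z -> z < y -> ~ nonstd_prime z)) \/
  y = 0 /\ ~ (exists z, 0 <= z /\ (x < z /\ nonstd_prime z)).

Lemma definable_nonstd_prime : definable nonstd_prime.
Proof. by move=> t ?; rewrite /nonstd_prime; dfn. Qed.

Lemma definable2_prime_after : definable2 prime_after.
Proof.
have ? := definable_nonstd_prime.
by move=> t u ? ?; rewrite /prime_after; dfn.
Qed.

Lemma prime_after_total x : 0 <= x -> exists2 y, 0 <= y & prime_after x y.
Proof.
move=> x0; have [ex|nex] :=
    pselect (exists z, 0 <= z /\ (x < z /\ nonstd_prime z)); last first.
  by exists 0 => //; right.
have ? := definable_nonstd_prime.
have [|y [y0 [xy y_pr] ymin]] := definable_min paM _ ex; first by move=> t ?; dfn.
exists y => //; left; do 3!split=> //; move=> z z0 xz zy z_pr.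
exact: ymin z0 zy _.
Qed.

Lemma prime_after_fun x y z : prime_after x y -> prime_after x z -> y = z.
Proof.
case=> [[y0 [xy [y_pr yP]]]|[-> ny]] [[z0 [xz [z_pr zP]]]|[-> nz]] //.
- by case: (ltgtP y z) => // [/(zP y y0 xy)|/(yP z z0 xz)].
- by case: nz; exists y.
- by case: ny; exists z.
Qed.

Lemma prime_after_nat k : prime_after k%:R (next_prime k)%:R.
Proof.
rewrite /next_prime; case: ex_minnP => p /andP[kp p_pr] pmin.
left; split=> //; split; first by rewrite ltr_nat.
split=> [|z z0 kz zp]; first by rewrite nonstd_prime_nat.
have [m zE _] := fin_nat paM z0 (ltW zp).
rewrite zE nonstd_prime_nat => m_pr.
have := pmin m; rewrite m_pr -(ltr_nat M) -zE kz => /(_ isT).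
by rewrite -(ler_nat M) -zE leNgt zp.
Qed.

(** Extends the enumeration of the standard primes to all indices in [M], which makes membership in
    a coded set a definable predicate of the index. *)
Definition prime_graph : M -> M -> Prop := rec_graph prime_after 2%:R.

Lemma definable2_prime_graph : definable2 prime_graph.
Proof. exact/definable2_rec_graph/definable2_prime_after. Qed.

Lemma prime_graph_fun x y z : 0 <= x -> 0 <= y -> 0 <= z ->
  prime_graph x y -> prime_graph x z -> y = z.
Proof.
exact: (rec_graph_fun paM (ler0n M 2) prime_after_total prime_after_fun).
Qed.

Lemma prime_graph_nat n : prime_graph n%:R (nth_prime n)%:R.
Proof.
elim: n => [|n IH]; first by apply: (rec_graph0 paM); apply: ler0n.
rewrite -natr1; apply: (rec_graphS paM (ler0n M 2) prime_after_total
  prime_after_fun _ _ _ IH); rewrite ?ler0n //.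
exact: prime_after_nat.
Qed.

Lemma nonneg_val_numeral n :
  nonneg_val (numeral (nonneg_structure M) n : nonneg M) = n%:R.
Proof. by elim: n => //= n IH; rewrite -natr1 -IH. Qed.

Lemma coded_setE (a : nonneg_structure M) n :
  coded_set a n <-> divides (nth_prime n)%:R (nonneg_val a).
Proof.
rewrite /coded_set /=; split=> [[b /= <-]|[q [q0 aE]]].
  exists (nonneg_val b); split; first exact: nonneg_ge0.
  by rewrite -nonneg_val_numeral mulrC.
exists (to_nonneg q0); apply: val_inj.
by rewrite /= nonneg_val_numeral aE mulrC.
Qed.

Lemma coded_set_definable (a : nonneg_structure M) :
  exists2 P : M -> Prop, definable P & forall n, coded_set a n <-> P n%:R.
Proof.
have [? ?] := (definable2_divides (M := M), definable2_prime_graph).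
exists (fun x => exists p : M, 0 <= p /\ (prime_graph x p /\ divides p (nonneg_val a))).
  by move=> t ?; dfn.
move=> n; rewrite coded_setE; split=> [dvd|[p [p0 [np dvd]]]].
  by exists (nth_prime n)%:R; split=> //; split=> //; apply: prime_graph_nat.
by rewrite (prime_graph_fun _ _ p0 (prime_graph_nat n) np).
Qed.

(** For standard [m], a product of standard primes codes [P] up to [m]. Overspill yields a code
    valid up to some infinite [m], hence at all standard indices. *)
Lemma definable_coded_set P : definable P -> (exists x : M, posinf x) ->
  exists a : nonneg_structure M, forall n, coded_set a n <-> P n%:R.
Proof.
move=> Pd Mns; have [? ?] := (definable2_divides (M := M), definable2_prime_graph).
pose Q m := exists c, 0 <= c /\ forall x, 0 <= x -> x <= m ->
  forall p : M, 0 <= p -> prime_graph x p -> (divides p c <-> P x).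
have [||m [minf m0 [c [c0 cP]]]] := overspill paM (P := Q) _ Mns.
- by move=> t ?; rewrite /Q; dfn.
- move=> m; exists (\prod_(i < m.+1 | `[<P i%:R>]) nth_prime i)%:R.
  split=> [|x x0 /(fin_nat paM x0)[k -> km] p p0 kp]; first exact: ler0n.
  rewrite -(prime_graph_fun _ _ p0 (prime_graph_nat k) kp) // divides_nat.
  split=> [|Pk]; last first.
    have km1 : (k < m.+1)%N by [].
    by rewrite (bigD1 (Ordinal km1)) /=; [apply: dvdn_mulr|apply/asboolP].
  rewrite Euclid_dvd_prod ?nth_prime_prime //.
  rewrite big_has_cond => /hasP[i _ /andP[/asboolP Pi]].
  rewrite dvdn_prime2 ?nth_prime_prime // => /eqP ki.
  by rewrite -(count_nth_prime k) ki count_nth_prime.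
exists (to_nonneg c0) => n; rewrite coded_setE.
by apply: cP => //; [apply/ltW/minf|apply: prime_graph_nat].
Qed.

End StandardSystem.

(** * Transfer of definable sets and rational cuts between the models *)

Section Transfer.
Variables M N : realDomainType.
Hypothesis paM : PA_model (nonneg_structure M).
Hypothesis paN : PA_model (nonneg_structure N).
Hypothesis eq_SSy : standard_system (nonneg_structure M) =
  standard_system (nonneg_structure N).

Lemma definable_transfer (P : M -> Prop) : (exists x : M, posinf x) ->
  definable P -> exists2 Q : N -> Prop, definable Q & forall n, P n%:R <-> Q n%:R.
Proof.
move=> Mns Pd; have [a aP] := definable_coded_set paM Pd Mns.
have : standard_system (nonneg_structure M) (coded_set a) by exists a.
rewrite eq_SSy => -[b _ bE]; have [Q Qd QP] := coded_set_definable paN b.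
by exists Q => // n; rewrite -QP -aP bE.
Qed.

Lemma pairing_nat (R : numDomainType) p q :
  pairing p%:R q%:R = ((p + q) ^ 2 + p)%:R :> R.
Proof. by rewrite /pairing natrD natrX natrD. Qed.

(** The cut of [a / b] is a coded set of standard pairs [(p, q)]. After its transfer to [N], each
    finite part is realised just above [b'] times the largest fraction in it, and overspill realises
    all parts at once. *)
Lemma cut_transfer (a b : M) (b' : N) :
  0 < a -> posinf b -> posinf b' -> exists2 a' : N, 0 <= a' &
    forall p q : nat, (0 < q)%N -> (p%:R * b < q%:R * a) = (p%:R * b' < q%:R * a').
Proof.
move=> a0 binf b'inf; have b0 := binf 0; have b'0 := b'inf 0.
have [||P' P'd P'P] := @definable_transfer (fun k => exists p : M, 0 <= p /\
    exists q, 0 <= q /\ (k = pairing p q /\ p * b < q * a)).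
- by exists b.
- by move=> t ?; rewrite /pairing; dfn.
pose Q m := exists a' : N, 0 <= a' /\ forall p, 0 <= p -> forall q, 0 <= q ->
  p <= m -> q <= m -> 0 < q -> (P' (pairing p q) <-> p * b' < q * a').
have PE p q : P' (pairing p%:R q%:R) <-> p%:R * b < q%:R * a.
  rewrite pairing_nat -P'P -pairing_nat; split=> [[x [x0 [y [y0 [xyE]]]]]|lt_pq].
    by move/(pairingI paM) : xyE => []// <- <-.
  by exists p%:R; split=> //; exists q%:R.
have [|||m [minf m0 [a' [a'0 a'P]]]] := overspill paN (P := Q).
- by move=> t ?; rewrite /Q /pairing; dfn.
- by exists b'.
(* Denominators run up to [m + 1], so that the fraction [0 / 1] is available even for [m = 0]. *)
- move=> m; pose I := ('I_m.+1 * 'I_m.+2)%type.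
  pose S (i : I) := (0 < i.2)%N && ((i.1)%:R * b < (i.2)%:R * a).
  pose ratio (i : I) : rat := (i.1)%:R / (i.2)%:R.
  have S0 : S (ord0, inord 1) by rewrite /S /= inordK // mul0r mul1r.
  case: (arg_maxP ratio S0) => -[[p0 p0m] [q0 q0m]].
  rewrite /S /= => /andP[q00 pq0] maxP.
  have q0N : 0 < q0%:R :> N by rewrite ltr0n.
  have [|t [r [t0 r0 rq tE]]] := euclid paN _ q0N (x := p0%:R * b').
    by rewrite mulr_ge0 // ltW.
  (* [t + 1] exceeds [b' * p0 / q0] by at most [1], whereas a larger fraction [p / q] gives a
     product exceeding it by at least [b' / (q * q0)], which is infinite. *)
  exists (t + 1); split=> [|x x0 y y0]; first lra.
  move=> /(fin_nat paN x0)[p -> pm] /(fin_nat paN y0)[q -> qm].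
  rewrite ltr0n PE => qgt0; have qN : 0 < q%:R :> N by rewrite ltr0n.
  have qM : 0 < q%:R :> M by rewrite ltr0n.
  have q0M : 0 < q0%:R :> M by rewrite ltr0n.
  split=> [lt_pq|]; last first.
    apply: contraTT; rewrite -!leNgt => le_qp.
    have lt_pq : (p0 * q < q0 * p)%N.
      rewrite -(ltr_nat M) !natrM -(ltr_pM2r b0).
      apply: (@lt_le_trans _ _ (q%:R * (q0%:R * a))).
        by rewrite mulrAC [ltRHS]mulrC ltr_pM2r.
      by rewrite mulrCA -mulrA ler_pM2l.
    rewrite -(ler_pM2l q0N).
    have : (p0 * q).+1%:R <= (q0 * p)%:R :> N by rewrite ler_nat.
    rewrite -natr1 !natrM => le_pq.
    have := b'inf (q0 * q)%N; rewrite natrM => lt_b'.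
    have E : q%:R * (p0%:R * b') = q%:R * t * q0%:R + q%:R * r by rewrite tE; ring.
    have qr : 0 <= q%:R * r by rewrite mulr_ge0.
    have := ler_wpM2r (ltW b'0) le_pq.
    nra.
  have pm1 : (p < m.+1)%N by [].
  have qm2 : (q < m.+2)%N by rewrite ltnS ltnW.
  have := maxP (Ordinal pm1, Ordinal qm2); rewrite /S /= qgt0 lt_pq => /(_ isT).
  rewrite /ratio /= ler_pdivrMr ?ltr0n // mulrAC ler_pdivlMr ?ltr0n //.
  rewrite -!natrM ler_nat => le_pq.
  rewrite -(ltr_pM2l q0N); apply: (@le_lt_trans _ _ (q%:R * (p0%:R * b'))).
    rewrite !mulrA ler_wpM2r ?(ltW b'0) // -!natrM ler_nat mulnC.
    by rewrite [(q * _)%N]mulnC.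
  by rewrite tE mulrCA ltr_pM2l // mulrDr mulr1 [q0%:R * t]mulrC ltrD2l.
exists a' => // p q q0; apply/idP/idP.
  by rewrite -PE a'P ?ltr0n //; apply/ltW/minf.
by rewrite -a'P ?PE ?ltr0n //; apply/ltW/minf.
Qed.

End Transfer.

(** * Partial isomorphisms modulo finite elements *)

Definition much_less (R : numDomainType) (x y : R) : Prop :=
  forall n : nat, n%:R * `|x| < `|y|.

Definition arch_equiv (R : numDomainType) (x y : R) : Prop :=
  exists n : nat, `|x| <= n%:R * `|y| /\ `|y| <= n%:R * `|x|.

Record convex_subring (R : numDomainType) (C : R -> Prop) : Prop := {
  convex_subring1 : C 1;
  convex_subringB : forall x y, C x -> C y -> C (x - y);
  convex_subringM : forall x y, C x -> C y -> C (x * y);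
  convex_subring_convex : forall x y, `|x| <= `|y| -> C y -> C x }.

(* A relation between [R] and [S] is regarded as a partial isomorphism between
   the quotients of their additive groups by the finite elements. *)
Record partial_iso (R S : numDomainType) (G : R -> S -> Prop) : Prop := {
  partial_iso_fin : forall x y, fin x -> fin y -> G x y;
  partial_isoB : forall x y x' y', G x y -> G x' y' -> G (x - x') (y - y');
  partial_iso_pure : forall x y (n : nat),
    G (n.+1%:R * x) (n.+1%:R * y) -> G x y;
  partial_iso_posinf : forall x y, G x y -> (posinf x <-> posinf y) }.

Section Finite.
Variable R : realDomainType.
Implicit Types x y z : R.

Lemma fin_nat_num n : fin (n%:R : R).
Proof. by exists n; rewrite normr_nat. Qed.

Lemma fin0 : fin (0 : R).
Proof. exact: (fin_nat_num 0). Qed.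

Lemma finN x : fin x -> fin (- x).
Proof. by move=> [n xn]; exists n; rewrite normrN. Qed.

Lemma finD x y : fin x -> fin y -> fin (x + y).
Proof.
move=> [n xn] [m ym]; exists (n + m)%N.
by rewrite natrD (le_trans (ler_normD _ _)) // lerD.
Qed.

Lemma nfin x : ~ fin x <-> posinf `|x|.
Proof.
split=> [nf n|xi [n]]; last by rewrite leNgt xi.
by rewrite ltNge; apply/negP => xn; apply: nf; exists n.
Qed.

Lemma posinf_gt0 x : posinf x -> 0 < x.
Proof. by move/(_ 0). Qed.

Lemma posinf_le x y : x <= y -> posinf x -> posinf y.
Proof. by move=> xy xi n; apply: lt_le_trans xy. Qed.

Lemma posinf_nfin x : posinf x -> ~ fin x.
Proof. by move=> xi; rewrite nfin ger0_norm // ltW // posinf_gt0. Qed.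

Lemma posinfN_fin x : ~ posinf x -> ~ posinf (- x) -> fin x.
Proof.
move=> nx nNx; apply: contrapT; rewrite nfin.
by case: (ger0P x) => _.
Qed.

Lemma nfin_posinf x : ~ fin x -> posinf x \/ posinf (- x).
Proof.
by move=> nf; apply: contrapT => /not_orP[? ?]; apply/nf/posinfN_fin.
Qed.

Lemma posinf_pmull n x : posinf (n.+1%:R * x) <-> posinf x.
Proof.
have n0 : 0 < n.+1%:R :> R by rewrite ltr0n.
split=> xi m.
  by have := xi (n.+1 * m)%N; rewrite natrM ltr_pM2l.
apply: lt_le_trans (xi m) _; have := xi 0 => x0.
by rewrite ler_peMl ?ler1n // ltW.
Qed.

Lemma much_less_posinf x y : much_less x y -> ~ fin y -> forall n : nat,
  posinf (`|y| - n%:R * `|x|).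
Proof.
move=> xy /nfin yi n m; have := xy (2 * n)%N; have := yi (2 * m)%N.
by rewrite !natrM; lra.
Qed.

Lemma much_less_le x y z t : `|x| <= `|z| -> `|t| <= `|y| ->
  much_less z t -> much_less x y.
Proof.
move=> xz ty zt n; apply: le_lt_trans (lt_le_trans (zt n) ty).
by rewrite ler_wpM2l.
Qed.

Lemma much_lessN x y : ~ much_less x y -> exists n : nat, `|y| <= n%:R * `|x|.
Proof. by move=> /existsNP[n /negP]; rewrite -leNgt => ?; exists n. Qed.

Lemma much_less_trans x y z : much_less x y -> much_less y z -> much_less x z.
Proof.
move=> xy yz; apply: much_less_le yz => //.
by have := xy 1; rewrite mul1r; apply: ltW.
Qed.

Lemma arch_equiv_sym x y : arch_equiv x y -> arch_equiv y x.
Proof. by move=> [n [? ?]]; exists n. Qed.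

Lemma much_less_equivl x y z : arch_equiv x y -> much_less x z -> much_less y z.
Proof.
move=> [m [_ ym]] xz n; apply: le_lt_trans (xz (n * m)%N).
by rewrite natrM -mulrA ler_wpM2l.
Qed.

Lemma much_less_equivr x y z : arch_equiv x y -> much_less z x -> much_less z y.
Proof.
move=> [m [xm _]] zx n; have [->|z0] := eqVneq z 0.
  rewrite normr0 mulr0; have := zx 0%N; rewrite mul0r => x0.
  by rewrite normr_gt0; apply/eqP => y0; move: xm; rewrite y0 normr0 mulr0; lra.
have := lt_le_trans (zx (m.+1 * n)%N) xm; have y0 := normr_ge0 y.
rewrite natrM -mulrA -natr1; set t := n%:R * _ => lt_t.
rewrite ltNge; apply/negP => le_t; move: lt_t; apply/negP; rewrite -leNgt.
apply: (@le_trans _ _ (m%:R * t)); first by rewrite ler_wpM2l.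
by rewrite ler_wpM2r ?lerDl //; rewrite /t mulr_ge0.
Qed.

Lemma arch_equiv_trans x y z : arch_equiv x y -> arch_equiv y z -> arch_equiv x z.
Proof.
move=> [n [xy yx]] [m [yz zy]]; exists (n * m)%N; rewrite natrM; split.
  by apply: le_trans xy _; rewrite -mulrA ler_wpM2l.
by apply: le_trans zy _; rewrite [n%:R * _]mulrC -mulrA ler_wpM2l.
Qed.

Lemma much_lessN_equiv x y : ~ much_less x y -> ~ much_less y x -> arch_equiv x y.
Proof.
move=> /much_lessN[n yn] /much_lessN[m xm]; exists (n + m)%N.
rewrite natrD !mulrDl; have := normr_ge0 x; have := normr_ge0 y.
have n0 := ler0n R n; have m0 := ler0n R m; split; nra.
Qed.

Lemma much_less_equivB x y : much_less y x -> arch_equiv (x - y) x.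
Proof.
move=> /(_ 2%N) yx; have y0 := normr_ge0 y; exists 2%N; split.
  by have := ler_normB x y; lra.
by have := lerB_dist x y; lra.
Qed.

Section ConvexSubring.
Variable C : R -> Prop.
Hypothesis Cc : convex_subring C.

Lemma convex_subring0 : C 0.
Proof. by have := convex_subringB Cc (convex_subring1 Cc) (convex_subring1 Cc); rewrite subrr. Qed.

Lemma convex_subringN x : C x -> C (- x).
Proof. by move=> Cx; rewrite -sub0r; apply: convex_subringB convex_subring0 Cx. Qed.

Lemma convex_subringD x y : C x -> C y -> C (x + y).
Proof. by move=> Cx Cy; rewrite -[y]opprK; apply/(convex_subringB Cc)/convex_subringN. Qed.

Lemma convex_subring_nat n : C n%:R.
Proof.
elim: n => [|n IH]; first exact: convex_subring0.
by rewrite -natr1; apply: convex_subringD IH (convex_subring1 Cc).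
Qed.

Lemma convex_subring_fin x : fin x -> C x.
Proof.
move=> [n xn]; apply: (convex_subring_convex Cc) (convex_subring_nat n).
by rewrite normr_nat.
Qed.

Lemma convex_subring_norm x : C `|x| <-> C x.
Proof. by split; apply: (convex_subring_convex Cc); rewrite normr_id. Qed.

Lemma convex_subring_le_mul n x y : `|x| <= n%:R * `|y| -> C y -> C x.
Proof.
move=> xy Cy; apply: (convex_subring_convex Cc (y := n%:R * `|y|)).
  by rewrite [leRHS]ger0_norm // mulr_ge0.
by apply: (convex_subringM Cc); [apply: convex_subring_nat|apply/convex_subring_norm].
Qed.

Lemma convex_subring_equiv x y : arch_equiv x y -> C y -> C x.
Proof. by move=> [n [xy _]]; apply: convex_subring_le_mul xy. Qed.

Lemma convex_subring_much_less x y : C x -> ~ C y -> much_less x y.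
Proof.
by move=> Cx nCy n; rewrite ltNge; apply/negP => /convex_subring_le_mul /(_ Cx).
Qed.

End ConvexSubring.

Hypothesis paR : PA_model (nonneg_structure R).

(** The quotient by the finite elements is divisible, because a remainder modulo a standard number
    is finite. *)
Lemma div_fin x n : exists y, fin (x - n.+1%:R * y).
Proof.
have n0 : 0 < n.+1%:R :> R by rewrite ltr0n.
have [q [r [q0 r0 rn xE]]] := euclid paR (normr_ge0 x) n0.
have rf : fin r by exists n.+1; rewrite ger0_norm // ltW.
case: (ger0P x) xE => _ xE; first by exists q; rewrite xE mulrC addrAC subrr add0r.
exists (- q); have -> : x - n.+1%:R * - q = - r; last exact: finN.
by rewrite -[X in X - _]opprK xE; ring.
Qed.

(** If [x] is in [C], the witness is the integer square root of the absolute value of [y], which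
    stays outside [C] because [C] is closed under products. Otherwise it is an integer version of
    the geometric mean of the two absolute values. *)
Lemma much_less_between (C : R -> Prop) x y : convex_subring C ->
  much_less x y -> ~ C y ->
  exists z, [/\ 0 <= z, ~ C z, much_less x z & much_less z y].
Proof.
move=> Cc xy nCy; have y_inf : posinf `|y|.
  by apply/nfin => /(convex_subring_fin Cc).
have [Cx|nCx] := pselect (C x).
  have [c c0 [ccy ycc]] := isqrt paR (normr_ge0 y).
  have nCc : ~ C c.
    move=> Cc'; apply: nCy; apply/(convex_subring_norm Cc).
    have C1 := convex_subringD Cc Cc' (convex_subring1 Cc).
    apply: (convex_subring_convex Cc) (convex_subringM Cc C1 C1).
    by rewrite normr_id ger0_norm ?(ltW ycc) // mulr_ge0 ?addr_ge0.
  exists c; split=> //; first exact: convex_subring_much_less nCc.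
  move=> n; have : posinf `|c| by apply/nfin => /(convex_subring_fin Cc).
  rewrite ger0_norm // => /(_ n) nc; have c0' := posinf_gt0 y_inf.
  apply: lt_le_trans ccy; rewrite ltr_pM2r //.
  exact: le_lt_trans nc.
have x_inf : posinf `|x| by apply/nfin => /(convex_subring_fin Cc).
have x0 := posinf_gt0 x_inf.
have [q [r [q0 r0 rx yE]]] := euclid paR (normr_ge0 y) x0.
have [t t0 [ttq qtt]] := isqrt paR q0.
have t_inf : posinf t.
  move=> n; rewrite ltNge; apply/negP => tn.
  (* If [t <= n] then [q < (n + 1) ^ 2]; the extra [1] covers the remainder [r]. *)
  have := xy ((n + 1) * (n + 1) + 1)%N; rewrite natrD natrM natrD yE.
  have : q < (n%:R + 1) * (n%:R + 1) by apply: lt_le_trans qtt _; nra.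
  nra.
have c0 : 0 <= t * `|x| by rewrite mulr_ge0.
exists (t * `|x|); split=> //.
- move=> Cz; apply: nCx; apply: (convex_subring_convex Cc) Cz.
  by rewrite (ger0_norm c0) ler_peMl // (ltW (t_inf 1)).
- by move=> n; rewrite (ger0_norm c0) ltr_pM2r.
move=> n; rewrite (ger0_norm c0) yE mulrA.
apply: (@lt_le_trans _ _ (t * t * `|x|)); last by have := ler_wpM2r (ltW x0) ttq; lra.
by rewrite ltr_pM2r // ltr_pM2r ?t_inf // posinf_gt0.
Qed.

End Finite.

Section PartialIso.
Variables M N : realDomainType.
Variable G : M -> N -> Prop.
Hypothesis Giso : partial_iso G.
Implicit Types (x u : M) (y w : N).

Lemma partial_iso0 : G 0 0.
Proof. by apply: (partial_iso_fin Giso); apply: fin0. Qed.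

Lemma partial_isoN x y : G x y -> G (- x) (- y).
Proof. by rewrite -[- x]sub0r -[- y]sub0r; apply: partial_isoB partial_iso0. Qed.

Lemma partial_isoD x y u w : G x y -> G u w -> G (x + u) (y + w).
Proof.
move=> xy /partial_isoN uw; have := partial_isoB Giso xy uw.
by rewrite !opprK.
Qed.

Lemma partial_isoMn n x y : G x y -> G (n%:R * x) (n%:R * y).
Proof.
move=> xy; elim: n => [|n IH]; first by rewrite !mul0r; apply: partial_iso0.
by rewrite -!natr1 !mulrDl !mul1r; apply: partial_isoD.
Qed.

(** [G] preserves infinite positive elements only, so absolute values are compared through the sums
    and differences of the elements. *)
Lemma partial_iso_abs x y u w : G x y -> G u w ->
  posinf (`|u| - `|x|) -> posinf (`|w| - `|y|).
Proof.
move=> xy uw.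
have abs (u' : M) (w' : N) : G u' w' -> posinf (u' - `|x|) -> posinf (w' - `|y|).
  move=> uw' ux; have sub : posinf (w' - y).
    apply/(partial_iso_posinf Giso (partial_isoB Giso uw' xy)).
    by apply: posinf_le ux; rewrite lerB // ler_norm.
  have add : posinf (w' + y).
    apply/(partial_iso_posinf Giso (partial_isoD uw' xy)).
    by apply: posinf_le ux; rewrite lerD2l lerNl -normrN ler_norm.
  by case: (ger0P y) => _ //; rewrite opprK.
case: (ger0P u) => _ /abs; first by move/(_ _ uw)/posinf_le; apply; rewrite lerB ?ler_norm.
move/(_ _ (partial_isoN uw))/posinf_le; apply.
by rewrite lerB // -normrN ler_norm.
Qed.

Lemma partial_iso_fin_iff x y : G x y -> (fin x <-> fin y).
Proof.
move=> xy; have P := partial_iso_posinf Giso xy.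
have PN := partial_iso_posinf Giso (partial_isoN xy).
split=> xf; apply: posinfN_fin.
- by rewrite -P => /posinf_nfin.
- by rewrite -PN => /posinf_nfin; apply; apply: finN.
- by rewrite P => /posinf_nfin.
- by rewrite PN => /posinf_nfin; apply; apply: finN.
Qed.

(** As [u] is infinite, each inequality in [much_less x u] improves to an infinite difference, the
    kind of inequality that [G] preserves. *)
Lemma partial_iso_much_less x y u w : G x y -> G u w -> ~ fin u ->
  much_less x u -> much_less y w.
Proof.
move=> xy uw uf /much_less_posinf - /(_ uf) xu n.
have xuE : `|u| - n%:R * `|x| = `|u| - `|n%:R * x| by rewrite normrM normr_nat.
have := xu n; rewrite xuE => /(partial_iso_abs (partial_isoMn n xy) uw).
by move/posinf_gt0; rewrite subr_gt0 normrM normr_nat.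
Qed.

(** Passing from [n] to [n + 1] creates a slack of the size of [u], which is infinite and so
    survives the passage through [G]. *)
Lemma partial_iso_le_mul x y u w n : G x y -> G u w -> ~ fin u ->
  `|x| <= n%:R * `|u| -> `|y| <= n.+1%:R * `|w|.
Proof.
move=> xy uw /nfin uf xu.
have : posinf (`|n.+1%:R * u| - `|x|).
  by apply: posinf_le uf; rewrite normrM normr_nat -natr1 mulrDl; lra.
move=> /(partial_iso_abs xy (partial_isoMn _ uw))/posinf_gt0.
by rewrite subr_gt0 normrM normr_nat => /ltW.
Qed.

Lemma partial_iso_equiv x y u w : G x y -> G u w -> ~ fin x -> ~ fin u ->
  arch_equiv x u -> arch_equiv y w.
Proof.
move=> xy uw xf uf [n [xu ux]]; exists n.+1.
by split; apply: partial_iso_le_mul; eassumption.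
Qed.

End PartialIso.

Lemma partial_iso_swap (M N : numDomainType) (G : M -> N -> Prop) :
  partial_iso G -> partial_iso (fun y x => G x y).
Proof.
move=> [Gf GB Gp Gi]; split=> [y x yf xf|y x y' x'|y x n|y x xy].
- exact: Gf.
- exact: GB.
- exact: Gp.
- by rewrite (Gi _ _ xy).
Qed.

Section Divide.
Variables M N : realDomainType.
Variable G : M -> N -> Prop.
Hypothesis Giso : partial_iso G.
Hypothesis paM : PA_model (nonneg_structure M).
Hypothesis paN : PA_model (nonneg_structure N).

Lemma partial_iso_div (x : M) (y : N) n : G x y ->
  exists u w, G u w /\ fin (x - n.+1%:R * u).
Proof.
move=> xy; have [[u xu] [w yw]] := (div_fin paM x n, div_fin paN y n).
exists u, w; split=> //; apply: (partial_iso_pure Giso (n := n)).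
have := partial_isoB Giso xy (partial_iso_fin Giso xu yw).
by rewrite !subKr.
Qed.

End Divide.

(** * One step of the back-and-forth construction *)

(* The list [s] represents the finitely many archimedean classes outside [C]
   of elements of the domain of [G]. *)
Record stage (M N : realDomainType) (C C' : M -> Prop) (D D' : N -> Prop)
    (G : M -> N -> Prop) (s : seq (M * N)) : Prop := {
  stage_iso : partial_iso G;
  stage_bound : forall x y, G x y -> C' x /\ D' y;
  stage_baseL : forall x, C x -> exists y, G x y;
  stage_baseR : forall y, D y -> exists x, G x y;
  stage_base : forall x y, G x y -> (C x <-> D y);
  stage_reps : forall l, l \in s -> G l.1 l.2 /\ ~ C l.1;
  stage_classes : forall x y, G x y ->
    C x \/ exists2 l, l \in s & arch_equiv x l.1 }.

Lemma count_strict (T : eqType) (p q : pred T) (s : seq T) l :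
  l \in s -> q l -> ~~ p l -> (forall x, p x -> q x) -> (count p s < count q s)%N.
Proof.
move=> ls ql pl pq; elim: s ls => // x s IH; rewrite inE => /orP[/eqP<-|ls] /=.
  by rewrite ql (negbTE pl) add0n add1n ltnS; apply: sub_count.
case: (boolP (p x)) => [/pq ->|_]; first by rewrite ltn_add2l IH.
exact: ltn_addl (IH ls).
Qed.

Lemma stage_swap (M N : realDomainType) (C C' : M -> Prop) (D D' : N -> Prop) G s :
  convex_subring C -> stage C C' D D' G s ->
  stage D D' C C' (fun y x => G x y) [seq (l.2, l.1) | l <- s].
Proof.
move=> Cc [Gi Gb GL GR GCD Gr Gc]; split=> //.
- exact: partial_iso_swap.
- by move=> y x /Gb[].
- by move=> y x /GCD ->.
- move=> _ /mapP[l ls ->] /=; have [Gl nCl] := Gr l ls; split=> //.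
  by rewrite -(GCD _ _ Gl).
move=> y x xy; have [Dy|nDy] := pselect (D y); first by left.
right; have nCx : ~ C x by rewrite (GCD _ _ xy).
have [//|[l ls xl]] := Gc x y xy.
have [Gl nCl] := Gr l ls.
exists (l.2, l.1); first by apply/mapP; exists l.
apply: (partial_iso_equiv Gi xy Gl _ _ xl).
  by move/(convex_subring_fin Cc).
by move/(convex_subring_fin Cc).
Qed.

Section Forth.
Variables M N : realDomainType.
Hypothesis paM : PA_model (nonneg_structure M).
Hypothesis paN : PA_model (nonneg_structure N).
Hypothesis eq_SSy : standard_system (nonneg_structure M) =
  standard_system (nonneg_structure N).
Variables (C C' : M -> Prop) (D D' : N -> Prop).
Hypothesis Cc : convex_subring C.
Hypothesis C'c : convex_subring C'.
Hypothesis Dc : convex_subring D.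
Hypothesis D'c : convex_subring D'.
Hypothesis gapD : exists2 d, D' d & ~ D d.

Section Stage.
Variables (G : M -> N -> Prop) (s : seq (M * N)).
Hypothesis Gs : stage C C' D D' G s.
Let Gi : partial_iso G := stage_iso Gs.

(** Here [0] itself is a best approximation of [a] from the domain; a subtraction reduces the
    general case to this one. *)
Definition best_approximation (a : M) : Prop :=
  forall x y, G x y -> ~ much_less (a - x) a.

(* An element [u] of the domain approximating [a] better than [x0] uses up the
   class of [u - x0], which is one of the finitely many classes in [s]. *)
Lemma exists_best_approximation a : exists x y, G x y /\ best_approximation (a - x).
Proof.
(* [n] bounds the number of listed classes that do not lie above the class of [a - x0]; a better
   approximation lowers this number. *)
suff best n x0 y0 : G x0 y0 ->
    (count (fun l => `[< ~ much_less (a - x0) l.1 >]) s < n)%N ->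
    exists x y, G x y /\ forall u w, G u w -> ~ much_less (a - u) (a - x).
  have [x [y [xy xP]]] := best _ _ _ (partial_iso0 Gi) (ltnSn _).
  exists x, y; split=> // u w uw.
  rewrite -addrA -opprD; apply: xP; exact: (partial_isoD Gi xy uw).
elim: n x0 y0 => // n IH x0 y0 xy0; rewrite ltnS => le_n.
have [|/existsNP[u /existsNP[w]]] :=
  pselect (forall u w, G u w -> ~ much_less (a - u) (a - x0)); first by exists x0, y0.
move=> /not_implyP[uw /contrapT ua].
have ux0 : arch_equiv (u - x0) (a - x0).
  by have -> : u - x0 = (a - x0) - (a - u) by [ring]; apply: much_less_equivB.
have [Cux|[l ls uxl]] := stage_classes Gs (partial_isoB Gi uw xy0).
  (* Now [a - x0] lies in [C], so [a] is in the domain and approximates itself exactly. *)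
  have [t axt] := stage_baseL Gs (convex_subring_equiv Cc (arch_equiv_sym ux0) Cux).
  exists a, (t + y0); split; first by have := partial_isoD Gi axt xy0; rewrite subrK.
  by move=> v z _ /(_ 0%N); rewrite subrr normr0 mul0r ltxx.
have axl := arch_equiv_trans (arch_equiv_sym ux0) uxl.
apply: (IH u w uw); apply: leq_trans le_n; apply: (count_strict ls).
- apply/asboolP => /(much_less_equivr (arch_equiv_sym axl)) /(_ 1).
  by rewrite mul1r ltxx.
- by apply/negP => /asboolP; apply; apply: much_less_equivr axl ua.
move=> x /asboolP nx; apply/asboolP => xl; apply: nx.
exact: much_less_trans ua xl.
Qed.

(** Otherwise dividing [u] by [k + 1], up to a finite error, would give an element of the domain
    approximating [a] too well. *)
Lemma best_approximation_mull a u w k : posinf a -> best_approximation a ->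
  G u w -> ~ much_less (k.+1%:R * a - u) a.
Proof.
move=> a_inf a_best uw kau; have [x [y [xy [m xm]]]] := partial_iso_div Gi paM paN k uw.
apply: (a_best x y xy) => n; have lt_m : (2 * n * m)%:R < `|a|.
  by rewrite gtr0_norm ?a_inf // posinf_gt0.
have := kau (2 * n)%N.
have le_ax : `|a - x| <= `|k.+1%:R * a - u| + `|u - k.+1%:R * x|.
  apply: le_trans (ler_normD _ _); rewrite addrA subrK -mulrBr normrM normr_nat.
  by rewrite ler_peMl ?ler1n.
have := ler_wpM2l (ler0n M n) le_ax; have := ler_wpM2l (ler0n M n) xm.
by move: lt_m; rewrite !natrM; lra.
Qed.

Lemma best_approximation_mulz a u w (k : int) :
  posinf a -> best_approximation a -> k != 0 -> G u w ->
  ~ much_less (u + k%:~R * a) a.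
Proof.
move=> a_inf a_best; case: k => [[|k]|k] // _ uw ua.
  by have := best_approximation_mull (k := k) a_inf a_best (partial_isoN Gi uw);
    rewrite opprK addrC; apply.
apply: (best_approximation_mull a_inf a_best uw) => m.
by rewrite distrC; have := ua m; rewrite NegzE mulrNz mulNr; apply.
Qed.

Lemma best_approximation_notin a w (k : int) :
  posinf a -> best_approximation a -> k != 0 -> ~ G (k%:~R * a) w.
Proof.
move=> a_inf a_best k0 /(partial_isoN Gi).
move=> /(best_approximation_mulz a_inf a_best k0); apply => m.
by rewrite addNr normr0 mulr0 normr_gt0 gt_eqF // posinf_gt0.
Qed.

(** The group generated by [G] and [(a, b)], closed under division by positive integers so that
    purity is kept. *)
Definition extend a b u w : Prop :=
  exists (n : nat) (k : int), G (n.+1%:R * u - k%:~R * a) (n.+1%:R * w - k%:~R * b).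

Lemma extendS a b u w : G u w -> extend a b u w.
Proof. by exists 0%N, 0; rewrite !mul1r !mul0r !subr0. Qed.

Lemma extend_new a b : extend a b a b.
Proof. by exists 0%N, 1; rewrite !mul1r !subrr; apply: partial_iso0 Gi. Qed.

(** One implication is enough for the [a] considered here: [u + k * a] is never finite, and its
    infinite negative case is the positive case for [- u] and [- k]. *)
Definition compatible a b : Prop := forall u w (k : int), G u w -> k != 0 ->
  posinf (u + k%:~R * a) -> posinf (w + k%:~R * b).

Lemma extend_iso a b : posinf a -> best_approximation a -> compatible a b ->
  partial_iso (extend a b).
Proof.
move=> a_inf a_best ab; split=> [x y xf yf|x y x' y'|x y m|x y].
- by apply: extendS; apply: partial_iso_fin Gi _ _ xf yf.
- move=> [n [k xy]] [m [l x'y']].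
  exists (n * m.+1 + m)%N, (m.+1%:Z * k - n.+1%:Z * l).
  have := partial_isoB Gi (partial_isoMn Gi m.+1 xy) (partial_isoMn Gi n.+1 x'y').
  have nmE : (n * m.+1 + m).+1 = (n.+1 * m.+1)%N by rewrite mulSn addnC.
  rewrite nmE natrM natrM !rmorphB !rmorphM /= -!pmulrn.
  by congr G; ring.
- move=> [n [k]]; rewrite !mulrA -!natrM => xy.
  by exists (n.+1 * m.+1).-1, k; rewrite prednK ?muln_gt0.
move=> [n [k xy]]; rewrite -(posinf_pmull n x) -(posinf_pmull n y).
set u := _ - _ in xy; set w := _ - _ in xy.
rewrite -[n.+1%:R * x](subrK (k%:~R * a)) -[n.+1%:R * y](subrK (k%:~R * b)).
rewrite -/u -/w; have [->|k0] := eqVneq k 0.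
  by rewrite !mul0r !addr0; apply: partial_iso_posinf Gi _ _ xy.
split=> [|wb_inf]; first exact: ab.
apply: contrapT => nua; have [uaf|] := pselect (fin (u + k%:~R * a)).
  have : G (k%:~R * a) (- w).
    have := partial_isoB Gi (partial_iso_fin Gi uaf (fin0 N)) xy.
    by rewrite addrAC subrr add0r sub0r.
  exact: best_approximation_notin.
move=> /nfin_posinf[//|]; rewrite opprD -mulNr -rmorphN => /ab.
move=> /(_ _ (partial_isoN Gi xy)); rewrite oppr_eq0 => /(_ k0)/posinf_gt0.
by rewrite rmorphN mulNr -opprD oppr_gt0 ltNge ltW // posinf_gt0.
Qed.

(** For [k != 0], either [u + k * a] has the class of [a], or [a] is much less than it and it shares
    the class of [u]. Hence one new representative is enough. *)
Lemma stage_extend a b : posinf a -> best_approximation a -> compatible a b ->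
  C' a -> D' b -> stage C C' D D' (extend a b) ((a, b) :: s).
Proof.
move=> a_inf a_best ab C'a D'b; have Ei := extend_iso a_inf a_best ab.
have na : ~ C a.
  move=> /(stage_baseL Gs)[y ay]; apply: (a_best _ _ ay) => m.
  by rewrite subrr normr0 mulr0 normr_gt0 gt_eqF // posinf_gt0.
split=> //.
- move=> x y [n [k /(stage_bound Gs)[C'x D'y]]]; split.
    apply: (convex_subring_convex C'c (y := n.+1%:R * x)).
      by rewrite normrM normr_nat ler_peMl ?ler1n.
    rewrite -[_ * x](subrK (k%:~R * a)); apply: (convex_subringD C'c) => //.
    apply: (convex_subringM C'c) => //; apply: (convex_subring_fin C'c).
    by exists `|k|%N; rewrite natr_absz intr_norm.
  apply: (convex_subring_convex D'c (y := n.+1%:R * y)).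
    by rewrite normrM normr_nat ler_peMl ?ler1n.
  rewrite -[_ * y](subrK (k%:~R * b)); apply: (convex_subringD D'c) => //.
  apply: (convex_subringM D'c) => //; apply: (convex_subring_fin D'c).
  by exists `|k|%N; rewrite natr_absz intr_norm.
- by move=> x /(stage_baseL Gs)[y xy]; exists y; apply: extendS.
- by move=> y /(stage_baseR Gs)[x xy]; exists x; apply: extendS.
- move=> x y xy; split=> [Cx|Dy].
    have [z xz] := stage_baseL Gs Cx.
    have := partial_isoB Ei xy (extendS a b xz).
    rewrite subrr => /(partial_iso_fin_iff Ei)[/(_ (fin0 _)) yzf _].
    rewrite -(subrK z y); apply: (convex_subringD Dc).
      exact: (convex_subring_fin Dc).
    by rewrite -(stage_base Gs xz).
  have [z zy] := stage_baseR Gs Dy.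
  have := partial_isoB Ei xy (extendS a b zy).
  rewrite subrr => /(partial_iso_fin_iff Ei)[_ /(_ (fin0 _)) xzf].
  rewrite -(subrK z x); apply: (convex_subringD Cc).
    exact: (convex_subring_fin Cc).
  by rewrite (stage_base Gs zy).
- move=> l; rewrite inE => /orP[/eqP->|/(stage_reps Gs)[ll nCl]] /=.
    by split=> //; apply: extend_new.
  by split=> //; apply: extendS.
move=> x y [n [k xy]].
have xnx : arch_equiv x (n.+1%:R * x).
  have := normr_ge0 x; have n1 : 1 <= n.+1%:R :> M by rewrite ler1n.
  exists n.+1; rewrite normrM normr_nat; split=> //; rewrite mulrA; nra.
set u := _ - _ in xy; have xE : n.+1%:R * x = u + k%:~R * a by rewrite subrK.
suff [Cu|[l ls ul]] : C (n.+1%:R * x) \/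
    exists2 l, l \in (a, b) :: s & arch_equiv (n.+1%:R * x) l.1.
- by left; apply: convex_subring_equiv xnx Cu.
- by right; exists l => //; apply: arch_equiv_trans ul.
have class z w : G z w -> C z \/ exists2 l, l \in (a, b) :: s & arch_equiv z l.1.
  move=> /(stage_classes Gs)[|[l ls zl]]; [by left|right].
  by exists l => //; rewrite inE ls orbT.
rewrite xE; have [->|k0] := eqVneq k 0; first by rewrite mul0r addr0; apply: class xy.
have nml := best_approximation_mulz a_inf a_best k0 xy.
have [aml|naml] := pselect (much_less a (u + k%:~R * a)); last first.
  by right; exists (a, b); [rewrite inE eqxx|apply: much_lessN_equiv].
have ux : arch_equiv u (u + k%:~R * a).
  rewrite -[X in arch_equiv X _](addrK (k%:~R * a)); apply: much_less_equivB => m.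
  apply: le_lt_trans (aml (m * `|k|)%N); rewrite natrM normrM -mulrA ler_wpM2l //.
  by rewrite natr_absz intr_norm.
have [Cu|[l ls ul]] := class _ _ xy.
  by left; apply: convex_subring_equiv (arch_equiv_sym ux) Cu.
by right; exists l => //; apply: arch_equiv_trans (arch_equiv_sym ux) ul.
Qed.

Lemma nat_multiple_bracket (c x : M) n : 0 < c -> c <= n%:R * x ->
  exists p : nat, p%:R * x < c /\ c <= p.+1%:R * x.
Proof.
move=> c0; elim: n => [|n IH] cn; first by rewrite mul0r leNgt c0 in cn.
by have [/IH|nc] := leP c (n%:R * x); last by exists n.
Qed.

(* The cut of [a / x] over the rationals determines [b], and comparing [u] with a
   multiple of [a] amounts to comparing both with a rational multiple of [x]. *)
Lemma exists_compatible_equiv a x y : posinf a -> best_approximation a ->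
  G x y -> posinf x -> arch_equiv a x -> exists2 b, D' b & compatible a b.
Proof.
move=> a_inf a_best xy x_inf [n]; have y_inf : posinf y.
  by apply/(partial_iso_posinf Gi xy).
have a0 := posinf_gt0 a_inf; have x0 := posinf_gt0 x_inf.
have y0 := posinf_gt0 y_inf.
rewrite (gtr0_norm a0) (gtr0_norm x0) => -[an xn].
have [b b0 bP] := cut_transfer paM paN eq_SSy a0 x_inf y_inf.
exists b.
  apply: (convex_subring_le_mul D'c (n := n) _ (proj2 (stage_bound Gs xy))).
  rewrite (ger0_norm b0) (gtr0_norm y0) leNgt.
  by have := bP n 1%N isT; rewrite !mul1r => <-; rewrite -leNgt.
move=> u w k uw k0 uka_inf.
have /much_lessN[m] := best_approximation_mulz a_inf a_best k0 uw.
rewrite (gtr0_norm a0) (gtr0_norm (posinf_gt0 uka_inf)) => am.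
(* From [a <= m * (u + k * a)] and [x <= n * a] follows [2 * x <= q * (u + k * a)]. Replacing the
   multiple of [a] by one of [x], with error at most [x], leaves an infinite surplus [x]. *)
pose q := (2 * n * m).+1.
have le_x : 2%:R * x <= q%:R * (u + k%:~R * a).
  rewrite /q -(natr1 (2 * n * m)) !natrM mulrDl mul1r.
  have := ler_wpM2l (ler0n M n) am; have := posinf_gt0 uka_inf; lra.
have bracket l : exists p : nat, p%:R * x < (q * l.+1)%:R * a /\
    (q * l.+1)%:R * a <= p.+1%:R * x.
  apply: (nat_multiple_bracket (n := q * l.+1 * n)).
    by rewrite mulr_gt0 // ltr0n muln_gt0.
  by rewrite (natrM _ (q * l.+1) n) -mulrA ler_wpM2l.
apply/(posinf_pmull (2 * n * m)); rewrite -/q.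
case: k k0 uka_inf am le_x => [[|l]|l] // _ uka_inf am le_x.
  have [p [pa ap]] := bracket l.
  have : posinf (q%:R * u + p%:R * x).
    apply: posinf_le x_inf; move: le_x ap; rewrite -pmulrn -natr1 natrM; lra.
  have G1 := partial_isoD Gi (partial_isoMn Gi q uw) (partial_isoMn Gi p xy).
  rewrite (partial_iso_posinf Gi G1) bP ?muln_gt0 // in pa *.
  by apply: posinf_le; move: pa; rewrite -pmulrn natrM; lra.
have [p [pa ap]] := bracket l.
have : posinf (q%:R * u - p.+1%:R * x).
  apply: posinf_le x_inf; move: le_x pa.
  by rewrite NegzE mulrNz -pmulrn -(natr1 p) natrM; lra.
have G1 := partial_isoB Gi (partial_isoMn Gi q uw) (partial_isoMn Gi p.+1 xy).
rewrite (partial_iso_posinf Gi G1); move: ap.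
rewrite leNgt bP ?muln_gt0 // -leNgt => ap.
apply: posinf_le; move: ap.
by rewrite NegzE mulrNz -pmulrn natrM; lra.
Qed.

(** The largest element is sought among the images, since the gap for [b] must be found in [N];
    [(0, 0)] is the default when no listed class lies below [a]. *)
Lemma lower_representative a (t : seq (M * N)) : posinf a ->
  (forall l, l \in t -> G l.1 l.2) ->
  exists x y, [/\ G x y, much_less x a &
    forall l, l \in t -> much_less l.1 a -> `|l.2| <= `|y|].
Proof.
move=> a_inf; elim: t => [|l t IH] tG.
  exists 0, 0; split=> //; first exact: partial_iso0 Gi.
  by move=> n; rewrite normr0 mulr0 normr_gt0 gt_eqF // posinf_gt0.
have [|x [y [xy xa yP]]] := IH.
  by move=> i it; apply: tG; rewrite inE it orbT.
have Gl := tG l (mem_head l t).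
have [[la ly]|nla] := pselect (much_less l.1 a /\ `|y| < `|l.2|).
  exists l.1, l.2; split=> // i; rewrite inE => /orP[/eqP->//|it ia].
  by apply: le_trans (ltW ly); apply: yP.
exists x, y; split=> // i; rewrite inE => /orP[/eqP-> la|it ia]; last exact: yP.
by rewrite leNgt; apply/negP => ly; apply: nla.
Qed.

Lemma upper_representative a (t : seq (M * N)) :
  (forall l, l \in t -> G l.1 l.2) ->
  (forall l, l \in t -> ~ much_less a l.1) \/
  exists x y, [/\ G x y, much_less a x &
    forall l, l \in t -> much_less a l.1 -> `|y| <= `|l.2|].
Proof.
elim: t => [|l t IH] tG; first by left.
have Gl := tG l (mem_head l t).
have [|none|[x [y [xy xa yP]]]] := IH.
- by move=> i it; apply: tG; rewrite inE it orbT.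
- have [al|nal] := pselect (much_less a l.1); last first.
    by left=> i; rewrite inE => /orP[/eqP->//|]; apply: none.
  right; exists l.1, l.2; split=> // i; rewrite inE => /orP[/eqP->//|it ia].
  by case: (none i it).
right; have [[al ly]|nal] := pselect (much_less a l.1 /\ `|l.2| < `|y|).
  exists l.1, l.2; split=> // i; rewrite inE => /orP[/eqP->//|it ia].
  by apply: le_trans (ltW ly) _; apply: yP.
exists x, y; split=> // i; rewrite inE => /orP[/eqP-> la|it ia]; last exact: yP.
by rewrite leNgt; apply/negP => ly; apply: nal.
Qed.

(** [b] is placed between the images of the classes next to [a]. Every [u] in the domain is much
    less or much greater than [a], so one term of [u + k * a] decides its sign, and the
    corresponding term decides that of [w + k * b]. *)
Lemma exists_compatible_new a : posinf a ->
  (forall x y, G x y -> ~ arch_equiv x a) -> exists2 b, D' b & compatible a b.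
Proof.
move=> a_inf a_new; have a0 := posinf_gt0 a_inf.
have nCa : ~ C a.
  move=> /(stage_baseL Gs)[y /a_new]; apply; exists 1%N.
  by rewrite mul1r.
have sG l : l \in s -> G l.1 l.2 by move=> /(stage_reps Gs)[].
have [x [y [xy xa yP]]] := lower_representative a_inf sG.
have [z [nDz D'z yz zP]] : exists z, [/\ ~ D z, D' z, much_less y z &
    forall l, l \in s -> much_less a l.1 -> `|z| <= `|l.2|].
  have [none|[u [w [uw au wP]]]] := upper_representative a sG.
    have [d D'd nDd] := gapD; have /nfin d_inf : ~ fin d.
      by move/(convex_subring_fin Dc).
    have D'n v : D' v -> D' `|v| by rewrite (convex_subring_norm D'c).
    (* No listed class lies above [a]. The square dominates [y] because [d] is infinite, and it lies
       outside [D] because it is at least the absolute value of [d]. *)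
    exists ((`|y| + `|d|) * (`|y| + `|d|)); split.
    - move=> Dz; apply: nDd; apply: (convex_subring_convex Dc) Dz.
      rewrite [leRHS]ger0_norm ?mulr_ge0 ?addr_ge0 //.
      have := normr_ge0 y; have := d_inf 1%N; nra.
    - have D'yd : D' (`|y| + `|d|).
        apply: (convex_subringD D'c); apply: D'n => //.
        exact: (proj2 (stage_bound Gs xy)).
      exact: (convex_subringM D'c).
    - move=> n; rewrite [ltRHS]ger0_norm ?mulr_ge0 ?addr_ge0 //.
      have := d_inf n; have := d_inf 0%N; have := normr_ge0 y; have := ler0n N n; nra.
    by move=> l /none.
  have nCu : ~ C u.
    move=> Cu; apply: nCa; apply: (convex_subring_convex Cc) Cu.
    by have := au 1%N; rewrite mul1r; apply: ltW.
  exists w; split=> //.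
  - by rewrite -(stage_base Gs uw).
  - exact: (proj2 (stage_bound Gs uw)).
  apply: (partial_iso_much_less Gi xy uw); first by move/(convex_subring_fin Cc).
  exact: much_less_trans xa au.
have [b [b0 nDb yb bz]] := much_less_between paN Dc yz nDz.
have b_inf : posinf b.
  by have /nfin : ~ fin b; [move/(convex_subring_fin Dc)|rewrite ger0_norm].
have low u w : G u w -> much_less u a -> much_less w b.
  move=> uw ua; have [Cu|nCu] := pselect (C u).
    by apply: (convex_subring_much_less Dc) nDb; rewrite -(stage_base Gs uw).
  have [//|[l ls ul]] := stage_classes Gs uw; have [Gl nCl] := stage_reps Gs ls.
  have wl : arch_equiv w l.2.
    by apply: (partial_iso_equiv Gi uw Gl) => // /(convex_subring_fin Cc).
  apply: much_less_equivl (arch_equiv_sym wl) _.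
  apply: much_less_le yb => //; apply: yP => //.
  exact: much_less_equivl ul ua.
have high u w : G u w -> much_less a u -> much_less b w.
  move=> uw au; have [Cu|nCu] := pselect (C u).
    case: nCa; apply: (convex_subring_convex Cc) Cu.
    by have := au 1%N; rewrite mul1r; apply: ltW.
  have [//|[l ls ul]] := stage_classes Gs uw; have [Gl nCl] := stage_reps Gs ls.
  have wl : arch_equiv w l.2.
    by apply: (partial_iso_equiv Gi uw Gl) => // /(convex_subring_fin Cc).
  apply: much_less_equivr (arch_equiv_sym wl) _.
  apply: much_less_le bz => //; apply: zP => //.
  exact: much_less_equivr ul au.
exists b; first by apply: (convex_subring_convex D'c) D'z; have := bz 1%N; rewrite mul1r => /ltW.
have b0' := posinf_gt0 b_inf.
move=> u w k uw k0 uka_inf; have uka0 := posinf_gt0 uka_inf.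
have [ua|nua] := pselect (much_less u a).
  have wb := low u w uw ua; case: k k0 uka_inf uka0 => [[|m]|m] // _ uka_inf uka0.
    (* Doubling avoids halves: twice the absolute value of [w] is below [b], hence
       [2 * (w + k * b) >= b]. *)
    apply/(posinf_pmull 1); apply: posinf_le b_inf; have := wb 2%N.
    have : b <= m.+1%:R * b by rewrite ler_peMl ?ler1n // ltW.
    have := ler_norm (- w); rewrite normrN (gtr0_norm b0') -pmulrn; lra.
  have : a <= m.+1%:R * a by rewrite ler_peMl ?ler1n // ltW.
  move: uka0; rewrite NegzE mulrNz mulNr -pmulrn.
  by have := ua 1%N; have := ler_norm u; rewrite (gtr0_norm a0); lra.
have [au|nau] := pselect (much_less a u); last first.
  by case: (a_new u w uw); apply: much_lessN_equiv.
have bw := high u w uw au.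
have kE (R : realDomainType) (c : R) : 0 < c -> `|k%:~R * c| = `|k|%N%:R * c.
  by move=> c0; rewrite normrM natr_absz intr_norm (gtr0_norm c0).
have u_inf : posinf u.
  have u0 : 0 < u.
    rewrite ltNge; apply/negP => u0; have := au `|k|%N.
    rewrite (gtr0_norm a0) (ler0_norm u0) -kE //.
    by have := ler_norm (k%:~R * a); lra.
  apply: posinf_le a_inf; have := au 1%N.
  by rewrite mul1r (gtr0_norm a0) (gtr0_norm u0) => /ltW.
have w_inf : posinf w by rewrite -(partial_iso_posinf Gi uw).
have w0 := posinf_gt0 w_inf.
apply/(posinf_pmull 1); apply: posinf_le w_inf; have := bw (2 * `|k|)%N.
rewrite (gtr0_norm b0') (gtr0_norm w0) natrM -mulrA -kE //.
by have := ler_norm (- (k%:~R * b)); rewrite normrN; lra.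
Qed.

Lemma stage_forth a : C' a -> exists G' s', [/\ stage C C' D D' G' s',
  forall x y, G x y -> G' x y & exists b, G' a b].
Proof.
have pos c : posinf c -> best_approximation c -> C' c -> exists G' s',
    [/\ stage C C' D D' G' s', forall x y, G x y -> G' x y & exists b, G' c b].
  move=> c_inf c_best C'c'; suff [b D'b cb] : exists2 b, D' b & compatible c b.
    exists (extend c b), ((c, b) :: s); split; first exact: stage_extend.
      by move=> x y; apply: extendS.
    by exists b; apply: extend_new.
  have [[x [y [xy xc]]]|nxc] := pselect (exists x y, G x y /\ arch_equiv x c).
    have nfx : ~ fin x.
      move=> [n xn]; case: xc => m [_]; have := c_inf (m * n)%N.
      rewrite (gtr0_norm (posinf_gt0 c_inf)) natrM.
      by have := ler_wpM2l (ler0n M m) xn; lra.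
    have [x_inf|x_inf] := nfin_posinf nfx.
      exact: exists_compatible_equiv c_inf c_best xy x_inf (arch_equiv_sym xc).
    apply: (exists_compatible_equiv c_inf c_best (partial_isoN Gi xy) x_inf).
    by case: xc => n [? ?]; exists n; rewrite normrN.
  by apply: exists_compatible_new => // x y xy xc; apply: nxc; exists x, y.
move=> C'a; have [x [y [xy x_best]]] := exists_best_approximation a.
have C'ax : C' (a - x).
  by apply: (convex_subringB C'c) C'a _; case: (stage_bound Gs xy).
have [axf|/nfin_posinf[ax_inf|ax_inf]] := pselect (fin (a - x)).
- exists G, s; split=> //; exists y; rewrite -[a](subrK x) -[y]add0r.
  apply: (partial_isoD Gi) xy; apply: (partial_iso_fin Gi) => //; exact: fin0.
- have [G' [s' [G's GG' [b axb]]]] := pos _ ax_inf x_best C'ax.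
  exists G', s'; split=> //; exists (b + y); rewrite -[a](subrK x).
  exact: (partial_isoD (stage_iso G's) axb (GG' _ _ xy)).
have [||G' [s' [G's GG' [b axb]]]] := pos _ ax_inf.
- move=> u w uw ml; apply: (x_best _ _ (partial_isoN Gi uw)) => n.
  by have := ml n; rewrite -opprD !normrN opprK.
- exact: (convex_subringN C'c).
exists G', s'; split=> //; exists (y - b).
have -> : a = x - - (a - x) by ring.
exact: (partial_isoB (stage_iso G's) (GG' _ _ xy) axb).
Qed.

End Stage.
End Forth.

(** * Extension to the whole models *)

Local Open Scope classical_set_scope.

Lemma countable_subset (T : Type) (A B : set T) :
  A `<=` B -> countable B -> countable A.
Proof. by move=> /subset_card_le; apply: sub_countable. Qed.

Lemma countable_image (T U : Type) (f : T -> U) (A : set T) :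
  countable A -> countable (f @` A).
Proof. exact/sub_countable/card_image_le. Qed.

Lemma countable_enumeration (T : Type) (x0 : T) (A : set T) : countable A ->
  exists e : nat -> T, forall x, A x -> exists n, e n = x.
Proof.
move=> /countable_injP[f f_inj].
have /choice[e eP] n : exists x, forall y, A y -> f y = n -> x = y.
  have [[y [Ay fy]]|nE] := pselect (exists y, A y /\ f y = n).
    by exists y => z Az fz; apply: f_inj; [exact/mem_set|exact/mem_set|rewrite fy fz].
  by exists x0 => y Ay fy; case: nE; exists y.
by exists e => x Ax; exists (f x); apply: eP.
Qed.

Lemma partial_iso_union (R S : numDomainType) (I : Type) (G : I -> R -> S -> Prop) :
  (exists i : I, True) -> (forall i, partial_iso (G i)) ->
  (forall i j, exists k, (forall x y, G i x y -> G k x y) /\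
    (forall x y, G j x y -> G k x y)) ->
  partial_iso (fun x y => exists i, G i x y).
Proof.
move=> [i0 _] Gi dir; split=> [x y xf yf|x y x' y' [i xy] [j x'y']|x y n [i xy]|x y [i xy]].
- by exists i0; apply: (partial_iso_fin (Gi i0)).
- have [k [ik jk]] := dir i j; exists k.
  by apply: (partial_isoB (Gi k)); [apply: ik|apply: jk].
- by exists i; apply: (partial_iso_pure (Gi i)) xy.
- exact: (partial_iso_posinf (Gi i)).
Qed.

Lemma convex_subring_union (R : numDomainType) (I : Type) (C : I -> R -> Prop) :
  (exists i : I, True) -> (forall i, convex_subring (C i)) ->
  (forall i j, exists k, (forall x, C i x -> C k x) /\ (forall x, C j x -> C k x)) ->
  convex_subring (fun x => exists i, C i x).
Proof.
move=> [i0 _] Cc dir; split=> [|x y [i xi] [j yj]|x y [i xi] [j yj]|x y xy [i yi]].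
- by exists i0; apply: convex_subring1.
- have [k [ik jk]] := dir i j; exists k.
  by apply: (convex_subringB (Cc k)); [apply: ik|apply: jk].
- have [k [ik jk]] := dir i j; exists k.
  by apply: (convex_subringM (Cc k)); [apply: ik|apply: jk].
by exists i; apply: (convex_subring_convex (Cc i)) yi.
Qed.

Definition domain (R S : Type) (G : R -> S -> Prop) (x : R) : Prop := exists y, G x y.

Definition codomain (R S : Type) (G : R -> S -> Prop) (y : S) : Prop := exists x, G x y.

(** The base is the domain and codomain of [G] itself, with no classes listed. Step [n] treats the
    [n]-th elements of both enumerations, so the list stays finite at every step while the union
    exhausts [C'] and [D']. *)
Lemma back_and_forth (M N : realDomainType)
    (paM : PA_model (nonneg_structure M)) (paN : PA_model (nonneg_structure N))
    (eq_SSy : standard_system (nonneg_structure M) =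
              standard_system (nonneg_structure N))
    (C' : M -> Prop) (D' : N -> Prop) (G : M -> N -> Prop) :
  partial_iso G -> convex_subring (domain G) -> convex_subring (codomain G) ->
  convex_subring C' -> convex_subring D' ->
  (forall x, domain G x -> C' x) -> (forall y, codomain G y -> D' y) ->
  (exists2 c, C' c & ~ domain G c) -> (exists2 d, D' d & ~ codomain G d) ->
  countable C' -> countable D' ->
  exists G', [/\ partial_iso G', forall x y, G x y -> G' x y,
    domain G' = C' & codomain G' = D'].
Proof.
move=> Gi Cc Dc C'c D'c CC' DD' gapC gapD C'count D'count.
pose st p := stage (domain G) C' (codomain G) D' p.1 p.2.
have st0 : st (G, [::]).
  split=> //=.
  - by move=> x y xy; split; [apply: CC'; exists y|apply: DD'; exists x].
  - by move=> x y xy; split=> _; [exists x|exists y].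
  - by move=> x y xy; left; exists y.
have forth p a : st p -> exists q, [/\ st q, forall x y, p.1 x y -> q.1 x y
    & C' a -> domain q.1 a].
  move=> ps; have [C'a|] := pselect (C' a); last by exists p.
  by have [H [t [Ht pH aH]]] := stage_forth paM paN eq_SSy Cc C'c Dc D'c gapD ps C'a;
    exists (H, t); split.
have back p b : st p -> exists q, [/\ st q, forall x y, p.1 x y -> q.1 x y
    & D' b -> codomain q.1 b].
  move=> ps; have [D'b|] := pselect (D' b); last by exists p.
  have [H [t [Ht pH bH]]] := stage_forth paN paM (esym eq_SSy) Dc D'c Cc C'c gapC
    (stage_swap Cc ps) D'b.
  exists (fun x y => H y x, [seq (l.2, l.1) | l <- t]).
  by split=> [|x y /pH //|_]; [apply: stage_swap Ht|].
have [eM eMP] := countable_enumeration 0 C'count.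
have [eN eNP] := countable_enumeration 0 D'count.
have step (pn : {p | st p} * nat) : exists q : {p | st p},
    [/\ forall x y, (sval pn.1).1 x y -> (sval q).1 x y,
        C' (eM pn.2) -> domain (sval q).1 (eM pn.2)
      & D' (eN pn.2) -> codomain (sval q).1 (eN pn.2)].
  case: pn => [[p ps] n] /=.
  have [q [qs pq qa]] := forth p (eM n) ps.
  have [r [rs qr rb]] := back q (eN n) qs.
  exists (exist _ r rs); split=> //= [x y /pq/qr //|/qa[y ay]].
  by exists y; apply: qr.
have [f fP] := choice step.
pose S := fix S n := if n is m.+1 then f (S m, m) else exist _ _ st0.
have Smono n m : (n <= m)%N ->
    forall x y, (sval (S n)).1 x y -> (sval (S m)).1 x y.
  elim: m => [|m IH]; first by rewrite leqn0 => /eqP ->.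
  rewrite leq_eqVlt => /orP[/eqP -> //|/IH nm] x y /nm.
  by have [+ _ _] := fP (S m, m); apply.
pose G' x y := exists n, (sval (S n)).1 x y.
have G'b x y : G' x y -> C' x /\ D' y.
  by move=> [n]; apply: stage_bound (svalP (S n)) _ _.
exists G'; split.
- apply: partial_iso_union => [|n|n m]; first by exists 0%N.
    exact: stage_iso (svalP (S n)).
  by exists (maxn n m); split; apply: Smono; rewrite ?leq_maxl ?leq_maxr.
- by move=> x y xy; exists 0%N.
- apply: funext => x; apply: propext; split=> [[y /G'b[]//]|C'x].
  have [n nx] := eMP x C'x; have [_ + _] := fP (S n, n).
  by rewrite nx => /(_ C'x)[y xy]; exists y, n.+1.
apply: funext => y; apply: propext; split=> [[x /G'b[]//]|D'y].
have [n ny] := eNP y D'y; have [_ _ +] := fP (S n, n).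
by rewrite ny => /(_ D'y)[x xy]; exists x, n.+1.
Qed.

(** * Countability in omega1-like models *)

Section Omega1Like.
Variable M : realDomainType.
Hypothesis paM : PA_model (nonneg_structure M).
Hypothesis omegaM : omega1_like (nonneg M).

Lemma omega1_like_segment (c : M) : countable [set x : M | `|x| <= c].
Proof.
have [c0|c0] := leP 0 c; last first.
  by apply: countable_subset (countable0 M) => x /=; have := normr_ge0 x; lra.
pose I := [set u : nonneg M | nonneg_val u <= c].
have c1 : 0 <= c + 1 by lra.
have Ic : countable I.
  apply: (proj2 omegaM) => [u v uv Iv|IT].
    exact: (le_trans (uv : nonneg_val u <= nonneg_val v) Iv).
  have : I (to_nonneg c1) by rewrite IT.
  by rewrite /I /=; lra.
pose f (k : bool) (u : nonneg M) := (-1) ^+ k * nonneg_val u.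
apply: countable_subset (bigcup_countable (D := [set: bool]) (F := fun k => f k @` I) _ _).
- move=> x /= xc; exists (x < 0) => //=.
  by exists (to_nonneg (normr_ge0 x)) => //; rewrite /f /= mulr_sign_norm.
- exact: countableP.
by move=> k _; apply: countable_image.
Qed.

Lemma omega1_like_uncountable : ~ countable [set: M].
Proof.
move=> Mc; apply: (proj1 omegaM).
have /countable_injP[f f_inj] := Mc; apply/countable_injP.
exists (fun u => f (nonneg_val u)) => u v _ _ /f_inj.
by rewrite !inE => /(_ I I)/val_inj.
Qed.

Lemma omega1_like_nonstandard : exists x : M, posinf x.
Proof.
apply: contrapT => nE; apply: omega1_like_uncountable.
apply: countable_subset (bigcup_countable (D := [set: nat])
  (F := fun n => [set x : M | `|x| <= n%:R]) _ _).
- move=> x _; apply: contrapT => nx; apply: nE; exists `|x| => n.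
  by rewrite ltNge; apply/negP => xn; apply: nx; exists n.
- exact: countableP.
by move=> n _; apply: omega1_like_segment.
Qed.

(** For infinite [a] this is the convex subring generated by [a]. *)
Definition power_ring (a x : M) : Prop := exists n : nat, `|x| <= `|a| ^+ n.

Lemma power_ring_convex_subring a : ~ fin a -> convex_subring (power_ring a).
Proof.
move=> /nfin a_inf; have a2 := a_inf 2%N; have a1 : 1 <= `|a| by lra.
have mono n m : (n <= m)%N -> `|a| ^+ n <= `|a| ^+ m by apply: ler_weXn2l.
split=> [|x y [n xn] [m ym]|x y [n xn] [m ym]|x y xy [n yn]].
- by exists 0%N; rewrite normr1 expr0.
- exists (maxn n m).+1; rewrite exprS.
  have := le_trans xn (mono _ _ (leq_maxl n m)).
  have := le_trans ym (mono _ _ (leq_maxr n m)).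
  have := ler_normB x y; have : 0 <= `|a| ^+ maxn n m by apply: exprn_ge0.
  nra.
- by exists (n + m)%N; rewrite normrM exprD ler_pM.
by exists n; apply: le_trans yn.
Qed.

Lemma power_ring_countable a : countable (power_ring a).
Proof.
apply: countable_subset (bigcup_countable (D := [set: nat])
  (F := fun n => [set x : M | `|x| <= `|a| ^+ n]) _ _).
- by move=> x [n xn]; exists n.
- exact: countableP.
by move=> n _; apply: omega1_like_segment.
Qed.

Lemma power_ring_self a : power_ring a a.
Proof. by exists 1%N; rewrite expr1. Qed.

Lemma sub_power_ring (C : M -> Prop) a : convex_subring C -> ~ C a ->
  forall x, C x -> power_ring a x.
Proof.
move=> Cc nCa x Cx; have := convex_subring_much_less Cc Cx nCa 1%N.
by rewrite mul1r => /ltW xa; exists 1%N; rewrite expr1.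
Qed.

Lemma convex_subring_countable (C : M -> Prop) a : convex_subring C -> ~ C a -> countable C.
Proof.
by move=> Cc nCa; apply: countable_subset (power_ring_countable a) => x;
  apply: sub_power_ring.
Qed.

End Omega1Like.

Lemma fin_convex_subring (R : realDomainType) : convex_subring (@fin R).
Proof.
split=> [|x y xf yf|x y [n xn] [m ym]|x y xy [n yn]].
- exact: (fin_nat_num R 1).
- exact/finD/finN.
- by exists (n * m)%N; rewrite normrM natrM ler_pM.
by exists n; apply: le_trans yn.
Qed.

Lemma fin_partial_iso (R S : realDomainType) :
  partial_iso (fun (x : R) (y : S) => fin x /\ fin y).
Proof.
have pure (T : realDomainType) (x : T) n : fin (n.+1%:R * x) -> fin x.
  apply: (convex_subring_convex (fin_convex_subring T)).
  by rewrite normrM normr_nat ler_peMl ?ler1n.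
split=> // [x y x' y' [xf yf] [x'f y'f]|x y n [/pure xf /pure yf] //|x y [xf yf]].
  by split; apply/finD/finN.
by split=> /posinf_nfin.
Qed.

(** Elements of [M] with a common partner differ by finite elements, so they lie in a translate of
    one countable segment. A proper codomain is countable and would cover [M] by countably many such
    translates. *)
Lemma codomain_full (M N : realDomainType) (paM : PA_model (nonneg_structure M))
    (omegaM : omega1_like (nonneg M)) (omegaN : omega1_like (nonneg N))
    (G : M -> N -> Prop) :
  partial_iso G -> (forall x, domain G x) -> convex_subring (codomain G) ->
  forall y, codomain G y.
Proof.
move=> Gi Gdom Gcod y; apply: contrapT => ny.
have cod_count := convex_subring_countable omegaN Gcod ny.
have [c c_inf] := omega1_like_nonstandard omegaM.
apply: (omega1_like_uncountable omegaM).
have /choice[h hP] z : exists x, codomain G z -> G x z.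
  by have [[x xz]|] := pselect (codomain G z); [exists x|exists 0].
apply: countable_subset (bigcup_countable (D := codomain G)
  (F := fun z => (fun x => h z + x) @` [set x : M | `|x| <= c]) cod_count _).
  move=> x _; have [z xz] := Gdom x; have cz : codomain G z by exists x.
  exists z => //; exists (x - h z); last by rewrite addrC subrK.
  have := partial_isoB Gi xz (hP z cz); rewrite subrr.
  move/(partial_iso_fin_iff Gi) => [_ /(_ (fin0 _))[n xn]].
  by apply: le_trans xn (ltW (c_inf n)).
by move=> z _; apply/countable_image/omega1_like_segment.
Qed.

Lemma exists_total_partial_iso (M N : realDomainType)
    (paM : PA_model (nonneg_structure M)) (paN : PA_model (nonneg_structure N))
    (omegaM : omega1_like (nonneg M)) (omegaN : omega1_like (nonneg N))
    (eq_SSy : standard_system (nonneg_structure M) =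
              standard_system (nonneg_structure N)) :
  exists G : M -> N -> Prop, [/\ partial_iso G,
    forall x, domain G x & forall y, codomain G y].
Proof.
pose good (G : M -> N -> Prop) :=
  [/\ partial_iso G, convex_subring (domain G) & convex_subring (codomain G)].
pose leG (G H : {G | good G}) := `[< forall x y, sval G x y -> sval H x y >].
have good0 : good (fun x y => fin x /\ fin y).
  split; first exact: fin_partial_iso.
    have -> : domain (fun (x : M) (y : N) => fin x /\ fin y) = @fin M.
      apply: funext => x; apply: propext; split=> [[y []]//|xf].
      by exists 0; split=> //; apply: fin0.
    exact: fin_convex_subring.
  have -> : codomain (fun (x : M) (y : N) => fin x /\ fin y) = @fin N.
    apply: funext => y; apply: propext; split=> [[x []]//|yf].
    by exists 0; split=> //; apply: fin0.
  exact: fin_convex_subring.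
have [|G H K /asboolP GH /asboolP HK||A Atot|G Gmax] := @Zorn {G | good G} leG.
- by move=> G; apply/asboolP.
- by apply/asboolP => x y /GH/HK.
- move=> [G Gg] [H Hg] /asboolP/= GH /asboolP/= HG; apply: eq_exist.
  apply: funext => x; apply: funext => y; apply: propext.
  by split; [apply: GH|apply: HG].
(* The empty chain is bounded by the isomorphism between the zero quotients. *)
- have [[G0 AG0]|A0] := pselect (exists G, A G); last first.
    by exists (exist _ _ good0) => G AG; case: A0; exists G.
  pose I := {G | A G}; pose F (i : I) := sval (sval i).
  have dir (i j : I) : exists k, (forall x y, F i x y -> F k x y) /\
      (forall x y, F j x y -> F k x y).
    have [/asboolP ij|/asboolP ji] := Atot _ _ (svalP i) (svalP j).
      by exists j; split.
    by exists i; split.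
  have Fg i : good (F i) := svalP (sval i).
  have i0 : I := exist _ G0 AG0.
  have goodU : good (fun x y => exists i, F i x y).
    split.
    - by apply: partial_iso_union dir; [exists i0|move=> i; case: (Fg i)].
    - have -> : domain (fun x y => exists i, F i x y) = fun x => exists i, domain (F i) x.
        by apply: funext => x; apply: propext;
          split=> [[y [i xy]]|[i [y xy]]]; [exists i, y|exists y, i].
      apply: convex_subring_union => [|i|i j]; [by exists i0|by case: (Fg i)|].
      have [k [ik jk]] := dir i j.
      by exists k; split=> x [y xy]; exists y; [apply: ik|apply: jk].
    have -> : codomain (fun x y => exists i, F i x y) = fun y => exists i, codomain (F i) y.
      by apply: funext => y; apply: propext;
        split=> [[x [i xy]]|[i [x xy]]]; [exists i, x|exists x, i].
    apply: convex_subring_union => [|i|i j]; [by exists i0|by case: (Fg i)|].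
    have [k [ik jk]] := dir i j.
    by exists k; split=> y [x xy]; exists x; [apply: ik|apply: jk].
  exists (exist _ _ goodU) => G AG; apply/asboolP => x y xy.
  by exists (exist _ G AG).
case: G Gmax => G [Gi Gd Gc] Gmax; exists G.
have [dom|/existsNP[a na]] := pselect (forall x, domain G x).
  by split=> //; apply: codomain_full.
have [cod|/existsNP[b nb]] := pselect (forall y, codomain G y).
  have := codomain_full paN omegaN omegaM (partial_iso_swap Gi) cod Gd.
  by split.
have af : ~ fin a by move/(convex_subring_fin Gd).
have bf : ~ fin b by move/(convex_subring_fin Gc).
have pa_ring := power_ring_convex_subring af.
have pb_ring := power_ring_convex_subring bf.
have pa_count := power_ring_countable omegaM a.
have pb_count := power_ring_countable omegaN b.
have [G' [G'i GG' G'd G'c]] := back_and_forth paM paN eq_SSy Gi Gd Gc pa_ring pb_ring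
  (sub_power_ring Gd na) (sub_power_ring Gc nb)
  (ex_intro2 _ _ a (power_ring_self a) na) (ex_intro2 _ _ b (power_ring_self b) nb)
  pa_count pb_count.
have G'g : good G' by split; rewrite ?G'd ?G'c.
have /(congr1 sval)/= GE := Gmax (exist _ G' G'g) (asboolT GG').
by case: na; rewrite -GE G'd; apply: power_ring_self.
Qed.

(** * The value group of the real closure *)

(** The largest term is minus the sum of the others: fewer than [n] terms, each at most a fraction
    [1 / (n + 1)] of it, cannot cancel it. *)
Lemma dominant_terms (K : rcfType) n (F : 'I_n -> K) (i0 : 'I_n) :
  F i0 != 0 -> \sum_i F i = 0 ->
  exists i k : 'I_n, [/\ i != k, F i != 0, F k != 0,
    finite_elt (F i / F k) & finite_elt (F k / F i)].
Proof.
move=> Fi0 sumF; pose i := [arg max_(i > i0) `|F i|]%O.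
have Fmax k : `|F k| <= `|F i| by rewrite /i; case: arg_maxP => // j _ /(_ k isT).
have Fi : F i != 0 by rewrite -normr_gt0 (lt_le_trans _ (Fmax i0)) // normr_gt0.
suff [k [ik Fk [m mP]]] : exists k, [/\ i != k, F k != 0 & finite_elt (F i / F k)].
  exists i, k; split=> //; first by exists m.
  exists 2%N; rewrite normrM normfV ltr_pdivrMr ?normr_gt0 //.
  by have := Fmax k; rewrite -normr_gt0 in Fi; lra.
apply: contrapT => nE.
have small k : k != i -> n.+1%:R * `|F k| <= `|F i|.
  move=> ki; have [->|Fk] := eqVneq (F k) 0; first by rewrite normr0 mulr0.
  rewrite leNgt; apply/negP => lt_n; apply: nE; exists k; split=> //.
    by rewrite eq_sym.
  by exists n.+1; rewrite normrM normfV ltr_pdivrMr ?normr_gt0.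
have le_sum : `|F i| <= \sum_(k | k != i) `|F k|.
  move: sumF; rewrite (bigD1 i) //= => /eqP; rewrite addr_eq0 => /eqP ->.
  by rewrite normrN; apply: ler_norm_sum.
have : n.+1%:R * `|F i| <= n%:R * `|F i|.
  apply: le_trans (ler_wpM2l (ler0n _ _) le_sum) _; rewrite mulr_sumr.
  apply: (@le_trans _ _ (\sum_(k | k != i) `|F i|)); first exact: ler_sum.
  rewrite sumr_const -[leLHS]mulr_natl ler_wpM2r // ler_nat.
  by rewrite (leq_trans (max_card _)) // card_ord.
by rewrite ler_pM2r ?normr_gt0 // ler_nat ltnn.
Qed.

Section ValueGroup.
Variable K : rcfType.
Implicit Types (x y : K).

Definition vK x (x0 : x != 0) : value_group K := v (Sub x x0 : nonzero K).

Lemma vKM x y (x0 : x != 0) (y0 : y != 0) (xy0 : x * y != 0) :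
  vK xy0 = vK x0 + vK y0.
Proof. by rewrite /vK -vM; congr v; apply: val_inj. Qed.

Lemma vK_le x y (x0 : x != 0) (y0 : y != 0) :
  (vK x0 <= vK y0) <-> finite_elt (y / x).
Proof. by split=> [/v_leP|h]; last apply/v_leP. Qed.

Lemma vK_eq x y (x0 : x != 0) (y0 : y != 0) :
  finite_elt (x / y) -> finite_elt (y / x) -> vK x0 = vK y0.
Proof. by move=> xy yx; apply/le_anti/andP; rewrite !vK_le. Qed.

Lemma vKX x (x0 : x != 0) n (xn0 : x ^+ n != 0) : vK xn0 = vK x0 *+ n.
Proof.
elim: n xn0 => [|n IH] xn0; first by congr v; apply: val_inj; rewrite /= expr0.
have xn0' : x ^+ n != 0 by rewrite expf_neq0.
have xxn0 := mulf_neq0 x0 xn0'.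
rewrite mulrS -(IH xn0') -(vKM _ _ xxn0); congr v; apply: val_inj.
by rewrite /= exprS.
Qed.

Lemma value_group_torsion_free (g : value_group K) n : g *+ n.+1 = 0 -> g = 0.
Proof.
have pos h : 0 <= h -> h *+ n.+1 = 0 -> h = 0 :> value_group K.
  move=> h0 hn; apply/le_anti; rewrite h0 andbT -hn mulrS -[leLHS]addr0.
  apply: value_group_leD; elim: (n) => [|m IH]; first by rewrite mulr0n.
  by rewrite mulrS; apply: le_trans IH _; rewrite addrC -[leLHS]addr0; apply: value_group_leD.
have /orP[g0|g0] : (0 <= g) || (g <= 0) := vle_total 0 g; first exact: pos.
move=> gn; apply: oppr_inj; rewrite oppr0; apply: pos; last by rewrite mulNrn gn oppr0.
by have := value_group_leD (- g) g0; rewrite addNr addr0.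
Qed.

End ValueGroup.

Lemma fraction_div (R : idomainType) (f : {fraction R}) :
  exists a b : R, b != 0 /\ f * tofrac b = tofrac a.
Proof.
exists (repr f).1, (repr f).2; split; first exact: denom_ratioP.
rewrite -{1}[f]reprK; unlock FracField.tofrac.
rewrite -[LHS]FracField.pi_mul; apply/eqP.
rewrite FracField.equivf_def /FracField.mulf.
rewrite !numden_Ratio ?mulf_neq0 ?denom_ratioP ?oner_neq0 // !mulr1.
by rewrite mulrC.
Qed.

Lemma max0_subN (R : realDomainType) (x : R) : Num.max x 0 - Num.max (- x) 0 = x.
Proof. by case: (leP x 0) => x0; case: (leP (- x) 0) => x1; lra. Qed.

Section Exponents.
Variables (M : realDomainType) (K : rcfType).
Hypothesis paM : PA_model (nonneg_structure M).
Variable j : {rmorphism {fraction M} -> K}.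
Hypothesis j_mono : {mono (fun a : M => j (tofrac a)) : a b / a <= b}.
Hypothesis j_alg : forall x : K, algebraicOver j x.
Variable E : M -> M.
Hypothesis E0 : E 0 = 1.
Hypothesis E_gt0 : forall n, 0 <= n -> 0 < E n.
Hypothesis ED : forall m n, 0 <= m -> 0 <= n -> E (m + n) = E m * E n.
Hypothesis E1 : E 1 = 2%:R.
Hypothesis E_log : forall a, 0 < a -> exists2 n, 0 <= n & E n <= a /\ a < 2%:R * E n.
Implicit Types (x y z p q : M).

Let i (a : M) : K := j (tofrac a).

Lemma embM a b : i (a * b) = i a * i b.
Proof. by rewrite /i !rmorphM. Qed.

Lemma emb_nat n : i n%:R = n%:R.
Proof. by rewrite /i !rmorph_nat. Qed.

Lemma emb0 : i 0 = 0.
Proof. exact: (emb_nat 0). Qed.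

Lemma emb1 : i 1 = 1.
Proof. exact: (emb_nat 1). Qed.

Lemma emb_le a b : (i a <= i b) = (a <= b).
Proof. exact: j_mono. Qed.

Lemma emb_lt a b : (i a < i b) = (a < b).
Proof. by rewrite !ltNge emb_le. Qed.

(** [2 ^ x] for signed [x], since [E] is controlled on nonnegative elements only. *)
Definition expo x : K := i (E (Num.max x 0)) / i (E (Num.max (- x) 0)).

Lemma emb_expo_gt0 p : 0 <= p -> 0 < i (E p).
Proof. by move=> p0; rewrite -emb0 emb_lt E_gt0. Qed.

Lemma expo_gt0 x : 0 < expo x.
Proof. by rewrite divr_gt0 // emb_expo_gt0 // le_max lexx orbT. Qed.

Lemma expo_neq0 x : expo x != 0.
Proof. by rewrite gt_eqF // expo_gt0. Qed.

Lemma expoE p q : 0 <= p -> 0 <= q -> expo (p - q) = i (E p) / i (E q).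
Proof.
move=> p0 q0; set m := Num.max (p - q) 0; set n := Num.max (- (p - q)) 0.
have m0 : 0 <= m by rewrite le_max lexx orbT.
have n0 : 0 <= n by rewrite le_max lexx orbT.
have [Eq0 En0] := (lt0r_neq0 (emb_expo_gt0 q0), lt0r_neq0 (emb_expo_gt0 n0)).
apply/eqP; rewrite /expo -/m -/n (eqr_div _ _ En0 Eq0) -!embM -!ED //.
apply/eqP; congr (i (E _)); apply/eqP; rewrite -subr_eq addrAC eq_sym -subr_eq.
by rewrite /m /n max0_subN.
Qed.

Lemma expo_nonneg p : 0 <= p -> expo p = i (E p).
Proof.
by move=> p0; rewrite -[p in LHS]subr0 expoE // E0 emb1 divr1.
Qed.

Lemma expoD x y : expo (x + y) = expo x * expo y.
Proof.
have pos z : 0 <= Num.max z 0 by rewrite le_max lexx orbT.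
have xyE : x + y = (Num.max x 0 + Num.max y 0) - (Num.max (- x) 0 + Num.max (- y) 0).
  by rewrite opprD addrACA !max0_subN.
by rewrite xyE expoE ?addr_ge0 // !ED // !embM invfM mulrACA.
Qed.

Lemma expoB x y : expo (x - y) = expo x / expo y.
Proof. by apply: (mulIf (expo_neq0 y)); rewrite -expoD subrK divfK ?expo_neq0. Qed.

Lemma expo_nat n : expo n%:R = 2%:R ^+ n.
Proof.
elim: n => [|n IH]; first by rewrite expo_nonneg // E0 emb1.
by rewrite -natr1 expoD IH expo_nonneg // E1 emb_nat exprSr.
Qed.

Lemma expo_ge1 x : 0 <= x -> 1 <= expo x.
Proof.
by move=> x0; rewrite expo_nonneg // -emb1 emb_le (discrete paM) // E_gt0.
Qed.

(** The bound is one-sided because an infinite negative exponent gives an infinitesimal, which is a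
    finite element. *)
Lemma finite_expo x : finite_elt (expo x) <-> exists n : nat, x <= n%:R.
Proof.
rewrite /finite_elt gtr0_norm ?expo_gt0 //; split=> [[n xn]|[n xn]].
  exists n; rewrite leNgt; apply/negP => nx; move: xn; apply/negP; rewrite -leNgt.
  have -> : x = (x - n%:R) + n%:R by rewrite subrK.
  rewrite expoD expo_nat; have x1 : 1 <= expo (x - n%:R).
    by apply: expo_ge1; rewrite subr_ge0 ltW.
  have : n%:R <= 2%:R ^+ n :> K by rewrite -natrX ler_nat ltnW // ltn_expl.
  move=> /le_trans; apply; rewrite ler_peMl // exprn_ge0 //.
exists (2 ^ n).+1; rewrite -natr1 natrX -expo_nat.
have -> : n%:R = (n%:R - x) + x by rewrite subrK.
rewrite expoD; have x1 : 1 <= expo (n%:R - x) by apply: expo_ge1; rewrite subr_ge0.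
by have := ler_peMl (ltW (expo_gt0 x)) x1; lra.
Qed.

Definition vexpo x : value_group K := vK (expo_neq0 x).

Lemma vexpoD x y : vexpo (x + y) = vexpo x + vexpo y.
Proof.
have xy0 := mulf_neq0 (expo_neq0 x) (expo_neq0 y).
by rewrite -(vKM _ _ xy0); congr v; apply: val_inj; rewrite /= expoD.
Qed.

(** This is where the order is reversed: dividing by a larger power of [2] leaves a smaller
    quotient, and values are compared through such quotients. *)
Lemma vexpo_le x y : (vexpo x <= vexpo y) <-> exists n : nat, y - x <= n%:R.
Proof. by rewrite vK_le -expoB finite_expo. Qed.

Lemma vexpo0 : vexpo 0 = 0.
Proof. by apply: (addrI (vexpo 0)); rewrite -vexpoD !addr0. Qed.

Lemma vexpoB x y : vexpo (x - y) = vexpo x - vexpo y.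
Proof. by apply: (addIr (vexpo y)); rewrite -vexpoD !subrK. Qed.

Lemma vexpoMn x n : vexpo (n%:R * x) = vexpo x *+ n.
Proof.
elim: n => [|n IH]; first by rewrite mul0r vexpo0.
by rewrite -natr1 mulrDl mul1r vexpoD IH mulrSr.
Qed.

Lemma vexpo_fin x : fin x -> vexpo x = 0.
Proof.
move=> [n xn]; apply/le_anti/andP; rewrite -vexpo0 !vexpo_le; split; exists n.
  by rewrite sub0r (le_trans _ xn) // -normrN ler_norm.
by rewrite subr0 (le_trans _ xn) // ler_norm.
Qed.

Lemma vK_emb a (a0 : i a != 0) : exists x, vK a0 = vexpo x.
Proof.
have a1 : 0 < `|a|.
  by rewrite normr_gt0; apply: contraNneq a0 => ->; rewrite emb0.
have [n n0 [na an]] := E_log a1; exists n.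
have ia : `|i a| = i `|a|.
  case: (ger0P a) => [a2|a2]; first by rewrite ger0_norm // -emb0 emb_le.
  by rewrite ltr0_norm -?emb0 ?emb_lt // /i !rmorphN.
have wn := expo_gt0 n.
(* The absolute value of [a] lies between [2 ^ n] and [2 ^ (n + 1)], so both quotients are below
   [3]. *)
apply: vK_eq; exists 3%N; rewrite normrM normfV (gtr0_norm wn) ia expo_nonneg //.
  rewrite ltr_pdivrMr ?emb_expo_gt0 // -(emb_nat 3) -embM emb_lt.
  by apply: lt_le_trans an _; rewrite ler_wpM2r ?ler_nat // ltW // E_gt0.
rewrite ltr_pdivrMr -?emb0 ?emb_lt // -(emb_nat 3) -embM emb_lt.
by apply: le_lt_trans na _; rewrite ltr_pMl // ltr1n.
Qed.

Lemma vK_embed_fraction f (f0 : j f != 0) : exists x, vK f0 = vexpo x.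
Proof.
have [a [b [b0 fab]]] := fraction_div f.
have ib0 : i b != 0 by rewrite fmorph_eq0 tofrac_eq0.
have fb0 := mulf_neq0 f0 ib0.
have ia0 : i a != 0 by rewrite /i -fab rmorphM.
have [[x xE] [y yE]] := (vK_emb ia0, vK_emb ib0).
exists (x - y); rewrite vexpoB -xE -yE; apply: (addIr (vK ib0)); rewrite subrK.
by rewrite -(vKM _ _ fb0); congr v; apply: val_inj; rewrite /= /i -fab rmorphM.
Qed.

(* By [dominant_terms], two monomials [c_k a^k] and [c_l a^l] of an equation for
   [a] over the fraction field have the same value, hence [(l - k) v(a)] is in
   the divisible image of [vexpo]. *)
Lemma vexpo_surj (g : value_group K) : exists x, vexpo x = g.
Proof.
have [[a a0] <-] := v_surj g; rewrite -/(vK a0).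
have [q q0 /rootP] := j_alg a.
rewrite horner_coef size_map_poly => sum0.
pose F (k : 'I_(size q)) := (map_poly j q)`_k * a ^+ k.
have sz : (0 < size q)%N by rewrite size_poly_gt0.
have lt_sz : ((size q).-1 < size q)%N by rewrite prednK.
have F0 : F (Ordinal lt_sz) != 0.
  rewrite /F /= coef_map mulf_neq0 ?expf_neq0 //= fmorph_eq0.
  by rewrite -lead_coefE lead_coef_eq0.
have [k [l [kl Fk Fl klf lkf]]] := dominant_terms F0 sum0.
have Fv := vK_eq Fk Fl klf lkf.
wlog {kl lkf klf sum0} lt_kl : k l Fk Fl Fv / (k < l)%N.
  move=> wl; move: kl; rewrite neq_ltn => /orP[kl|lk].
    exact: wl Fv kl.
  exact: wl (esym Fv) lk.
have split_term (m : 'I_(size q)) (Fm : F m != 0) :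
    exists x, vK Fm = vexpo x + vK a0 *+ m.
  have am0 : a ^+ m != 0 by rewrite expf_neq0.
  have cm0 : j q`_m != 0.
    by move: (Fm); rewrite /F coef_map mulf_eq0 negb_or => /andP[].
  have [x xE] := vK_embed_fraction cm0; exists x.
  have cam0 := mulf_neq0 cm0 am0.
  rewrite -xE -(vKX a0 am0) -(vKM _ _ cam0); congr v; apply: val_inj.
  by rewrite /= /F coef_map.
have [x xE] := split_term k Fk; have [y yE] := split_term l Fl.
(* Equal values of the terms [k] and [l] give [(l - k) v(a) = vexpo (x - y)]. Dividing [x - y] by
   [l - k] leaves a finite error, of value [0], and torsion-freeness cancels [l - k]. The
   predecessor matches [n.+1] in [div_fin]. *)
have [z zf] := div_fin paM (x - y) (l - k).-1.
exists z; apply/esym/subr0_eq/(value_group_torsion_free (n := (l - k).-1)).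
have lk : (l - k).-1.+1 = (l - k)%N by rewrite prednK // subn_gt0.
rewrite mulrnBl -vexpoMn.
have := vexpo_fin zf; rewrite !vexpoB => /subr0_eq <-.
rewrite lk mulrnBr ?(ltnW lt_kl) //.
have := xE; rewrite Fv yE => E'.
apply/eqP; rewrite subr_eq0; apply/eqP.
apply: (addrI (vexpo y)); rewrite addrA E' [RHS]addrC subrK.
by rewrite -addrA subrr addr0.
Qed.

End Exponents.

Lemma exists_value_map (M : realDomainType) (K : rcfType) :
  PA_model (nonneg_structure M) -> is_real_closure M K ->
  exists phi : M -> value_group K,
    [/\ forall x y, phi (x - y) = phi x - phi y,
        forall x y, (phi x <= phi y) <-> ~ posinf (y - x)
      & forall g, exists x, phi x = g].
Proof.
move=> paM [j [j_mono j_alg]].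
have [E [E0 E_gt0 ED E1 E_log]] := exp2_exists paM.
exists (vexpo j_mono E_gt0); split.
- exact: vexpoB.
- move=> x y; rewrite vexpo_le //; split=> [[n xn] /(_ n)|/existsNP[n /negP]].
    by rewrite ltNge xn.
  by rewrite -leNgt; exists n.
exact: vexpo_surj.
Qed.

Theorem theorem3p1 (M N : realDomainType)
    (paM : PA_model (nonneg_structure M)) (paN : PA_model (nonneg_structure N))
    (omegaM : omega1_like (nonneg M)) (omegaN : omega1_like (nonneg N))
    (eq_SSy : standard_system (nonneg_structure M) =
              standard_system (nonneg_structure N))
    (RM RN : rcfType)
    (rcM : is_real_closure M RM) (rcN : is_real_closure N RN) :
  ordered_group_iso (value_group RM) (value_group RN).
Proof.
have [G [Gi Gd Gc]] := exists_total_partial_iso paM paN omegaM omegaN eq_SSy.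
have [phi [phiB phi_le phi_surj]] := exists_value_map paM rcM.
have [psi [psiB psi_le psi_surj]] := exists_value_map paN rcN.
(* Both [phi] and [psi] express the order through [posinf], which [G] preserves. Applied in both
   directions, this also absorbs the finite ambiguity of [G] and makes the induced map well defined
   and injective. *)
have le_iff x y x' y' : G x y -> G x' y' -> (phi x <= phi x') = (psi y <= psi y').
  move=> xy x'y'; have := partial_iso_posinf Gi (partial_isoB Gi x'y' xy).
  by move=> h; apply/idP/idP; rewrite phi_le psi_le h.
have eq_iff x y x' y' : G x y -> G x' y' -> (phi x = phi x') <-> (psi y = psi y').
  move=> xy x'y'; have [h h'] := (le_iff _ _ _ _ xy x'y', le_iff _ _ _ _ x'y' xy).
  split=> e; apply/le_anti; first by rewrite -h -h' e lexx.
  by rewrite h h' e lexx.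
have /choice[f fP] g : exists h, exists x y, [/\ phi x = g, G x y & psi y = h].
  by have [x xg] := phi_surj g; have [y xy] := Gd x; exists (psi y), x, y.
have fE x y : G x y -> f (phi x) = psi y.
  move=> xy; have [x' [y' [xx' x'y' <-]]] := fP (phi x).
  by apply/(eq_iff _ _ _ _ x'y' xy).
have fB : zmod_morphism f.
  move=> g h; have [x [y [<- xy _]]] := fP g; have [x' [y' [<- x'y' _]]] := fP h.
  by rewrite -phiB (fE _ _ (partial_isoB Gi xy x'y')) (fE _ _ xy) (fE _ _ x'y').
pose fadd := GRing.isZmodMorphism.Build _ _ f fB.
pose F : {additive value_group RM -> value_group RN} := HB.pack f fadd.
have f_le : {mono f : g h / g <= h}.
  move=> g h; have [x [y [<- xy _]]] := fP g; have [x' [y' [<- x'y' _]]] := fP h.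
  by rewrite (fE _ _ xy) (fE _ _ x'y') (le_iff _ _ _ _ xy x'y').
exists F; split=> //.
have /choice[k kP] h : exists g, f g = h.
  have [y yh] := psi_surj h; have [x xy] := Gc y.
  by exists (phi x); rewrite (fE _ _ xy).
exists k => [g|h]; last exact: kP.
by apply: (inc_inj f_le); apply: kP.
Qed.
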